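(* Let $(D_n)_{n\ge1}$ be connected regular domains of the family $\mathcal D$ such that $x_0\in D_1$, $D_n\Subset D_{n+1}$ for all $n$, and $D=\bigcup_{n\ge1}D_n$, and suppose that for every $n$ the relative kernel $K_{D_n}$ has a jointly continuous version on $D_n\times\partial D_n$ (this version is used). Let $\widehat D$ be a compact metrizable compactification of $D$, let $H=\mathcal H_1(D)$, and let $P$ and $T_n$ be as defined in the context. Fix a nonnegative harmonic function $u$ on $D$ and put $$d\lambda_n^u=u\,d\omega_{x_0}^{D_n},\qquad\rho_n^u=(T_n)_\#\lambda_n^u,\qquad\Lambda_n^u=(\mathrm{id},T_n)_\#\lambda_n^u,$$ so that $\rho_n^u$ is a measure on $P$ and $\Lambda_n^u$ is a measure on $\widehat D\times P$. Then: 1. $(\Lambda_n^u)$ has weakly convergent subsequences on $\widehat D\times P$. Every limit $\Lambda$ is carried by $(\widehat D\setminus D)\times H$ and satisfies $$\Lambda(\widehat D\times P)=u(x_0),\qquad u(x)=\int_{(\widehat D\setminus D)\times H}g(x)\,d\Lambda(\widehat\eta,g)\quad(x\in D).$$ 2. Every weak subsequential limit $\sigma$ of $(\rho_n^u)$ on $P$ is carried by $H$ and satisfies $u(x)=\int_Hg(x)\,d\sigma(g)$ for $x\in D$. 3. For every finite positive Borel measure $\tau$ on $H$ and every Borel $A\subseteq H$, the function $u_A(x):=\int_Ag(x)\,d\tau(g)$ is continuous and harmonic on $D$, and $u_A(x_0)=\tau(A)$. It is strictly positive if $\tau(A)>0$ and is zero otherwise.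
   Context: Let $X$ be a metric space. A domain is a nonempty connected open set; $V\Subset U$ means that $\overline V$ is compact and contained in $U$. Measures are positive Borel measures (completed when integrable functions are considered). A harmonic measure on a domain $U$ with $\partial U\ne\varnothing$ is a family $\{\omega_x^U:x\in U\}$ of measures on $\partial U$ with $\omega_x^U(\partial U)=1$ and $\omega_x^U\ll\omega_y^U$ for all $x,y\in U$; write $\omega_x^U(f)=\int_{\partial U}f\,d\omega_x^U$. It is continuous if $x\mapsto\omega_x^U(f)$ is continuous on $U$ for every $f\in\bigcap_{x\in U}L^1(\partial U,\omega_x^U)$, and Radon if every $\omega_x^U$ is Radon. The domain $U$ is regular if for every $\zeta\in\partial U$ and every bounded Borel $f$ on $\partial U$ continuous at $\zeta$ one has $\omega_x^U(f)\to f(\zeta)$ as $U\ni x\to\zeta$. Standing framework: $\mathcal D$ is a family of domains of $X$, each with nonempty boundary and equipped with a continuous Radon harmonic measure, such that (i) every $U\in\mathcal D$ is the union of an increasing sequence of regular domains of $\mathcal D$ whose closures are compact and contained in $U$; (ii) for $V\Subset U$ in $\mathcal D$ with $V$ regular, $\omega_x^U(f)=\int_{\partial V}\omega_y^U(f)\,d\omega_x^V(y)$ for all $x\in V$ and all bounded Borel $f$ on $\partial U$. $D\subseteq X$ is a domain and $x_0\in D$ is fixed. A function $u:W\to\mathbb R$ on an open set $W$ is harmonic if it is continuous and $u(x)=\int_{\partial V}u\,d\omega_x^V$ for every regular $V\in\mathcal D$ with $V\Subset W$ and every $x\in V$. $\mathcal H_1(D)$ is the set of strictly positive harmonic functions $h$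 on $D$ with $h(x_0)=1$, with the topology of locally uniform convergence. For regular $U\in\mathcal D$ with $U\Subset D$, $x_0\in U$, $K_U(x,y)=\frac{d\omega_x^U}{d\omega_{x_0}^U}(y)$. Compact product: put $L_m=\overline{D_m}$, $a_m=\min_{L_m\times\partial D_{m+1}}K_{D_{m+1}}>0$, $b_m=\max_{L_m\times\partial D_{m+1}}K_{D_{m+1}}$, $\Omega_m(s,t)=\max_{z\in\partial D_{m+1}}|K_{D_{m+1}}(s,z)-K_{D_{m+1}}(t,z)|$. Let $\mathcal Q_m\subset C(L_m)$ (uniform norm) be the compact convex set of all $g\in C(L_m)$ that are harmonic in $D_m$, satisfy $g(x_0)=1$, and satisfy $a_i\le g(s)\le b_i$ and $|g(s)-g(t)|\le\Omega_i(s,t)$ for all $s,t\in L_i$ and all $i\le m$. It contains $g|_{L_m}$ for $g\in\mathcal H_1(D)$, the constant $1$, and $K_{D_n}(\cdot,y)|_{L_m}$ for $n\ge m+2$, $y\in\partial D_n$. Put $P=\prod_{m\ge1}\mathcal Q_m$ and identify $\mathcal H_1(D)$ with the closed subset of $P$ of sequences compatible under restriction, via $g\mapsto(g|_{L_m})_m$. Define the continuous maps $T_n:\partial D_n\to P$ by $T_n(y)_m=K_{D_n}(\cdot,y)|_{L_m}$ if $m\le n-2$ and $T_n(y)_m=1$ if $m>n-2$. In $\Lambda_n^u$, $\mathrm{id}$ is the inclusion $\partial D_n\subset D\subset\widehat D$. A compactification of $D$ is a compact Hausdorff space containing $D$ as a dense subspace; weak convergence of finite measures on a compact space is convergence of integrals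 of continuous functions; a measure is carried by a Borel set if the complement has measure zero; $f_\#\mu$ is the push-forward. *)

(* Defs.v *)
From HB Require Import structures.
From mathcomp Require Import all_boot all_order all_algebra.
From mathcomp Require Import all_classical all_reals all_analysis.
From mathcomp Require Import measurable_realfun.

Set Implicit Arguments.
Unset Strict Implicit.
Unset Printing Implicit Defensive.

Import Order.TTheory GRing.Theory Num.Theory.
Import numFieldNormedType.Exports.

Local Open Scope classical_set_scope.
Local Open Scope ring_scope.
Local Open Scope charge_scope.

(* Measurable types are pointed in the library, hence "pointed metric space";
   the point itself plays no role. *)
#[short(type="pmetricType")]
HB.structure Definition PointedMetric (K : numDomainType) :=
  {M of Metric K M & isPointed M}.

HB.instance Definition _ (A B : ptopologicalType) := Pointed.on (A * B)%type.

Notation borel T := (g_sigma_algebraType (@open T)).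

(* Throughout, a Borel measure on a subset S of T is represented by a Borel
   measure on T that is carried by S, and a function on S by a function on T
   of which only the values on S are used. *)
Section generalities.
Context {R : realType}.

Definition carried_by {d} {T : measurableType d} (mu : set T -> \bar R)
    (S : set T) : Prop :=
  measurable S /\ mu (~` S) = 0%E.

(* Weak convergence of measures on the compact subset K of T. *)
Definition weak_cvg {T : ptopologicalType} (K : set T)
    (mu_ : nat -> set (borel T) -> \bar R) (mu : set (borel T) -> \bar R) :=
  forall f : T -> R, {within K, continuous f} ->
    (\int[mu_ n]_(x in (K : set (borel T))) (f x)%:E)%E @[n --> \oo] -->
    (\int[mu]_(x in (K : set (borel T))) (f x)%:E)%E.

(* The measure f dmu on S. *)
Definition density {T : ptopologicalType} (mu : set (borel T) -> \bar R)
    (S : set (borel T)) (f : T -> R) (A : set (borel T)) : \bar R :=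
  (\int[mu]_(y in A `&` S) (f y)%:E)%E.

Definition inner_regular {T : ptopologicalType}
    (mu : set (borel T) -> \bar R) : Prop :=
  forall A : set (borel T), measurable A ->
    mu A = ereal_sup [set mu C | C in [set C : set T | compact C /\ C `<=` A]].

(* f is in L^1(S, mu) for the completion of mu. On a function which is only
   measurable for the completion, the library's integral (a supremum over
   Borel simple functions, for each of the positive and negative parts) is
   the integral with respect to the completion. *)
Definition L1_completed {T : ptopologicalType} (mu : set (borel T) -> \bar R)
    (S : set (borel T)) (f : T -> R) : Prop :=
  measurable_fun (S : set (g_sigma_algebraType (completed_algebra_gen mu))) f /\
  (\int[mu]_(y in S) `|(f y)%:E| < +oo)%E.

Definition bdry {T : topologicalType} (A : set T) : set T :=
  closure A `\` interior A.

Definition domain {T : topologicalType} (A : set T) : Prop :=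
  [/\ A !=set0, open A & connected A].

Definition rel_compact {T : topologicalType} (V U : set T) : Prop :=
  compact (closure V) /\ closure V `<=` U.

(* (T, j) is a compactification of the subspace D of X. *)
Definition compactification {X T : topologicalType} (D : set X) (j : X -> T) :=
  [/\ compact [set: T] /\ hausdorff_space T,
      {in D &, injective j},
      {within D, continuous j},
      (forall U : set X, open U ->
         exists2 W : set T, open W & j @` (D `&` U) = j @` D `&` W)
    & dense (j @` D)].

(* Extension by zero of a function defined on the subtype A. *)
Definition ext {X : Type} {A : set X} (g : A -> R) : X -> R := valL_ 0 g.

End generalities.

Section harmonic_measures.
Context {R : realType} {X : pmetricType R}.
Implicit Types (U : set X) (w : X -> probability (borel X) R).

Definition harmonic_measure U w : Prop :=
  [/\ bdry U !=set0,
      forall x, U x -> w x (bdry U) = 1%E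
    & forall x y, U x -> U y -> w x `<< w y].

Definition continuous_hm U w : Prop :=
  forall f : X -> R, (forall x, U x -> L1_completed (w x) (bdry U) f) ->
    {within U, continuous (fun x => \int[w x]_(y in bdry U) f y)}.

Definition radon_hm U w : Prop := forall x, U x -> inner_regular (w x).

Definition bounded_borel U (f : X -> R) : Prop :=
  measurable_fun (bdry U : set (borel X)) f /\ [bounded f y | y in bdry U].

Definition regular_dom U w : Prop :=
  forall (zeta : X) (f : X -> R), bdry U zeta -> bounded_borel U f ->
    f @ within (bdry U) (nbhs zeta) --> f zeta ->
    (\int[w x]_(y in bdry U) f y) @[x --> within U (nbhs zeta)] --> f zeta.

End harmonic_measures.

Section framework.
Context {R : realType} {X : pmetricType R}.
Variables (DD : set (set X)) (omega : set X -> X -> probability (borel X) R).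

Definition regular_domain (U : set X) : Prop := DD U /\ regular_dom U (omega U).

Definition harmonic_framework : Prop :=
  [/\ forall U, DD U ->
        [/\ domain U, harmonic_measure U (omega U),
            continuous_hm U (omega U) & radon_hm U (omega U)],
      forall U, DD U -> exists V : nat -> set X,
        [/\ forall n, regular_domain (V n) /\ rel_compact (V n) U,
            forall n, V n `<=` V n.+1
          & U = \bigcup_n V n]
    & forall U V, DD U -> regular_domain V -> rel_compact V U ->
        forall (f : X -> R) (x : X), bounded_borel U f -> V x ->
          \int[omega U x]_(z in bdry U) f z =
          \int[omega V x]_(y in bdry V) \int[omega U y]_(z in bdry U) f z].

Definition harmonic_in (W : set X) (u : X -> R) : Prop :=
  {within W, continuous u} /\
  forall V, regular_domain V -> rel_compact V W ->
    forall x, V x -> u x = \int[omega V x]_(y in bdry V) u y.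

(* k is a version, jointly continuous on U x bdry U, of the relative kernel
   (x, y) |-> (d omega_x^U / d omega_x0^U) (y). *)
Definition continuous_kernel (x0 : X) (U : set X) (k : X -> X -> R) : Prop :=
  (forall x, U x -> {ae omega U x0, forall y, bdry U y ->
     (k x y)%:E =
     ('d (charge_of_finite_measure (omega U x)) '/d (omega U x0)) y}) /\
  {within U `*` bdry U, continuous (fun p : X * X => k p.1 p.2)}.

End framework.

(* D -> R with uniform convergence on compact subsets of D; D being locally
   compact, this is locally uniform convergence. *)
Definition locunif {R : realType} {X : topologicalType} (D : set X) : Type :=
  {family compact, D -> R}.

HB.instance Definition _ (R : realType) (X : topologicalType) (D : set X) :=
  Topological.copy (@locunif R X D) {family compact, D -> R}.
HB.instance Definition _ (R : realType) (X : topologicalType) (D : set X) :=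
  isPointed.Build (@locunif R X D) (fun=> 0).

(* Product over m of the function spaces R^(L m), each with the topology of
   uniform convergence. *)
Definition unif_prod {R : realType} {X : topologicalType}
    (L : nat -> set X) : Type :=
  prod_topology (fun m => arrow_uniform_type (L m) R).

HB.instance Definition _ (R : realType) (X : topologicalType)
    (L : nat -> set X) :=
  Topological.copy (@unif_prod R X L)
    (prod_topology (fun m => arrow_uniform_type (L m) R)).
HB.instance Definition _ (R : realType) (X : topologicalType)
    (L : nat -> set X) :=
  isPointed.Build (@unif_prod R X L) (fun m => (fun=> 0)).

Unset Implicit Arguments.

Section compact_product.
Context {R : realType} {X : pmetricType R}.
Variables (DD : set (set X)) (omega : set X -> X -> probability (borel X) R).
Variables (x0 : X) (D : set X) (D_ : nat -> set X) (K : nat -> X -> X -> R).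

(* Sequences are indexed from 0 instead of 1; only differences of indices
   matter in what follows. *)
Definition L_ (m : nat) : set X := closure (D_ m).

(* inf and sup are attained: K m.+1 is continuous on a compact set. *)
Definition a_ (m : nat) : R :=
  inf [set K m.+1 s z | s in L_ m & z in bdry (D_ m.+1)].

Definition b_ (m : nat) : R :=
  sup [set K m.+1 s z | s in L_ m & z in bdry (D_ m.+1)].

Definition Omega_ (m : nat) (s t : X) : R :=
  sup [set `|K m.+1 s z - K m.+1 t z| | z in bdry (D_ m.+1)].

Definition Q_ (m : nat) : set (arrow_uniform_type (L_ m) R) :=
  [set g : L_ m -> R |
    [/\ continuous g, harmonic_in DD omega (D_ m) (ext g), ext g x0 = 1
      & forall i : nat, (i <= m)%N -> forall s t : X, L_ i s -> L_ i t ->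
          a_ i <= ext g s <= b_ i /\ `|ext g s - ext g t| <= Omega_ i s t]].

Definition P_ : set (@unif_prod R X L_) := [set p | forall m, Q_ m (p m)].

(* The values K n s y with s in D_ n and y in bdry (D_ n) are the only ones used;
   T_ n maps bdry (D_ n) into P_. *)
Definition T_ (n : nat) (y : X) : @unif_prod R X L_ :=
  fun m => if (m.+2 <= n)%N then sigL (L_ m) (K n ^~ y) else fun=> 1.

Definition H1 : set (@locunif R X D) :=
  [set h | [/\ forall x : D, 0 < h x, harmonic_in DD omega D (ext (A := D) h)
             & ext (A := D) h x0 = 1]].

Definition restrictions (h : @locunif R X D) : @unif_prod R X L_ :=
  fun m => sigL (L_ m) (ext (A := D) h).

(* H1 identified with a subset of the product. *)
Definition HP : set (@unif_prod R X L_) := restrictions @` H1.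

(* The value g(x) of the point g of HP. *)
Definition evalH (g : @unif_prod R X L_) (x : X) : R :=
  ext (A := D) (xget (fun=> 0) (H1 `&` [set h | restrictions h = g])) x.

Definition lambda_ (u : X -> R) (n : nat) : set (borel X) -> \bar R :=
  density (omega (D_ n) x0) (bdry (D_ n)) u.

Definition rho_ (u : X -> R) (n : nat) :
    set (borel (@unif_prod R X L_)) -> \bar R :=
  pushforward (lambda_ u n) (T_ n : borel X -> borel (@unif_prod R X L_)).

Definition Lambda_ (Dhat : ptopologicalType) (j : X -> Dhat) (u : X -> R)
    (n : nat) : set (borel (Dhat * @unif_prod R X L_)%type) -> \bar R :=
  pushforward (lambda_ u n)
    ((fun y => (j y, T_ n y)) :
       borel X -> borel (Dhat * @unif_prod R X L_)%type).

End compact_product.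

(* Main.v *)
From HB Require Import structures.
Require Import Defs.
From mathcomp Require Import all_boot all_order all_algebra.
From mathcomp Require Import all_classical all_reals all_analysis.
From mathcomp Require Import measurable_realfun ring lra.

Set Implicit Arguments.
Unset Strict Implicit.
Unset Printing Implicit Defensive.

Import Order.TTheory GRing.Theory Num.Theory.
Import numFieldNormedType.Exports.

Local Open Scope classical_set_scope.
Local Open Scope ring_scope.

(** Let h be harmonic and nonnegative on D. On D_n the measures omega_x^{D_n}
    have the densities K_n(x, .) with respect to omega_{x0}^{D_n}, so the mean
    value property of h reads h(x) = int K_n(x, y) h(y) d omega_{x0}^{D_n}(y)
    ([harmonic_kernel]). Everything rests on properties of these kernels.
    Harmonic measure charges every relatively open part of the boundary of a
    regular domain ([omega_full_support]), so identities and inequalities that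
    hold almost everywhere between functions continuous on the boundary hold
    everywhere there. Hence K_n(., y) is harmonic for every y
    ([kernel_harmonic]), nonnegative with value 1 at x0, and therefore strictly
    positive by a minimum principle ([kernel_gt0]). The representation then
    gives a Harnack inequality and a modulus of continuity common to all
    normalized positive harmonic functions ([harmonic_Harnack]). These bounds
    make each Q_m compact by an Ascoli argument ([Q_compact]), and they show
    that H_1(D), embedded in P by restriction, is exactly the closed set of
    compatible sequences of P ([HP_compatible]).

    The representation of u on D_n says that u(x) is the integral of
    p |-> p_m(x) against rho_n^u, as soon as n >= m + 2 and x is in L_m. This
    integrand is continuous on P, so the identity passes to weak limits
    ([limit_representation]); with a constant integrand one obtains the total
    mass ([limit_mass]). The sequence T_n(y) is compatible up to level n - 2,
    so the continuous functions p |-> |p_{m+1}(s) - p_m(s)| integrate to 0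
    against every limit; countably many of them detect incompatibility, and
    limits are carried by H ([limit_compatible]). In the same way Lambda gives
    no mass to the open sets j(D_m) x P, which are missed by the boundaries of
    all later D_n ([Lambda_limit_carried]).

    Weakly convergent subsequences exist because measures of given mass are
    weakly sequentially compact on a compact set C whose points are separated by
    countably many continuous functions ([weak_sequential_compactness]).
    Comparing the separating functions with rationals codes each point of C by a
    sequence of bits, and a diagonal subsequence makes the masses of all the sets
    of points with given first bits converge. The limit masses cut an interval
    into nested subintervals; following the bits of a point of the interval
    leads to a point of C, and the image of Lebesgue measure under this map is
    the limit.

    Finally, the averages of members of H_1(D) inherit their bounds and their
    modulus of continuity, and they are harmonic because the integrals may be
    exchanged. Here, as for the kernels, the joint measurability behind the
    exchange comes from equicontinuity ([Rintegral_swap_equicontinuous]). *)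

(** * Continuity and compactness *)

Section continuity_within.
Context {R : realType}.

Lemma within_continuousP (T : topologicalType) (A : set T) (f : T -> R) :
  {within A, continuous f} <->
  forall x, A x -> forall e, 0 < e -> \forall y \near x, A y -> `|f x - f y| < e.
Proof.
rewrite subspace_continuousP; split=> cf x Ax.
  by move=> e e0; have /cvgrPdist_lt/(_ _ e0) := cf x Ax.
by apply/cvgrPdist_lt => e e0; exact: cf.
Qed.

Lemma within_continuous_bounded (T : topologicalType) (A : set T) (f : T -> R) :
  compact A -> {within A, continuous f} ->
  exists2 M, 0 < M & forall x, A x -> `|f x| <= M.
Proof.
move=> cA cf; have /compact_bounded := continuous_compact cf cA.
move=> [M [_ Mb]]; exists (`|M| + 1); first by rewrite ltr_wpDl.
move=> x Ax; apply: (Mb (`|M| + 1)); last by exists x.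
by rewrite (le_lt_trans (ler_norm M))// ltrDl.
Qed.

Lemma closed_borel (T : ptopologicalType) (A : set (borel T)) :
  closed (A : set T) -> measurable A.
Proof.
move=> cA; rewrite -[A]setCK; apply: measurableC.
by apply: sub_sigma_algebra; exact: closed_openC.
Qed.

Lemma open_borel (T : ptopologicalType) (A : set (borel T)) :
  open (A : set T) -> measurable A.
Proof. by move=> oA; exact: sub_sigma_algebra. Qed.

Lemma within_continuous_measurable (T : ptopologicalType) (A : set (borel T))
    (f : T -> R) :
  {within (A : set T), continuous f} -> measurable_fun A (f : borel T -> R).
Proof.
move=> cf mA; suff: measurable_fun A (f : borel T -> R) by apply.
apply: (measurability _ (RGenOpens.measurableE R)).
move=> _ [_ [a [b ->] <-]].
have /open_subspaceP[V oV VA] :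
    @open (subspace (A : set T)) (f @^-1` `]a, b[%classic).
  by move/continuousP : cf; apply; exact: itv_open.
rewrite setIC -VA; apply: measurableI => //; exact: open_borel.
Qed.

End continuity_within.

Section compact_covers.
Context {T : ptopologicalType}.

Lemma compact_nbhs_cover (S : set T) (N : T -> set T) : compact S ->
  (forall x, S x -> nbhs x (N x)) ->
  exists2 s : seq T, (forall x, x \in s -> S x) &
    forall x, S x -> exists2 y, y \in s & N y x.
Proof.
rewrite compact_cover => cS nN.
have [||D' D'S Scov] := cS T S (fun x => (N x)^°).
- by move=> i _; exact: open_interior.
- by move=> x Sx; exists x => //; exact: nN.
exists (finmap.enum_fset D') => [x xD'|x /Scov[y /= yD' Nyx]].
  by have := D'S _ xD'; rewrite inE.
by exists y => //; exact: interior_subset.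
Qed.

End compact_covers.

Lemma compact_dense_seq {R : realType} {X : pmetricType R} (S : set X) (x0 : X) :
  compact S -> S x0 ->
  exists2 d : nat -> X, forall i, S (d i) &
    forall x e, S x -> 0 < e -> exists i, ball (d i) e x.
Proof.
move=> cS Sx0.
have net n : exists s : seq X, (forall x, x \in s -> S x) /\
    forall x, S x -> exists2 y, y \in s & ball y n.+1%:R^-1 x.
  have [|s sS scov] := @compact_nbhs_cover X S (fun x => ball x n.+1%:R^-1) cS.
    by move=> x _; apply: nbhsx_ballx.
  by exists s.
have [s /all_and2[sS scov]] := choice net.
pose d (i : nat) : X := if @unpickle (nat * nat)%type i is Some (n, k) then nth x0 (s n) k else x0.
exists d => [i|x e Sx e0].
  rewrite /d; case: unpickle => [[n k]|//].
  have [kn|kn] := ltnP k (size (s n)); first exact/(sS n)/mem_nth.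
  by rewrite nth_default.
have [n ne] : exists n : nat, n.+1%:R^-1 < e.
  have [n _ /(_ n (leqnn n))] := near_infty_natSinv_lt (PosNum e0).
  by exists n.
have [y ys yx] := scov n x Sx.
exists (@pickle (nat * nat)%type (n, index y (s n))).
by rewrite /d pickleK nth_index//; apply: le_ball yx; exact: ltW.
Qed.

Lemma within_continuous_compose {Y T Z : topologicalType} (B : set Y)
    (K : set T) (F : Y -> T) (f : T -> Z) : {within B, continuous F} ->
  (forall y, B y -> K (F y)) -> {within K, continuous f} ->
  {within B, continuous (f \o F)}.
Proof.
move=> /subspace_continuousP cF FK /subspace_continuousP cf.
apply/subspace_continuousP => y By.
apply: (@cvg_comp _ _ _ F f _ (within K (nbhs (F y)))); last exact/cf/FK.
move=> V KV.
have h : \forall z \near within B (nbhs y), K (F z) -> V (F z) := cF y By _ KV.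
have w : \forall z \near within B (nbhs y), B z by exact: withinT.
suff : \forall z \near within B (nbhs y), V (F z) by [].
by apply: filterS2 h w => z hz Bz; apply: hz; exact: FK.
Qed.

Section tube.
Context {R : realType} {S T : topologicalType}.

(** Joint continuity gives at each z a neighbourhood of y0; compactness of C
    makes one of them work for all z. *)
Lemma tube_near (C : set S) (D : set T) (f : S -> T -> R) (y0 : T) (eps : R) :
  compact C -> {within C `*` D, continuous (fun p : S * T => f p.1 p.2)} ->
  D y0 -> 0 < eps ->
  \forall y \near y0, D y -> forall z, C z -> `|f z y0 - f z y| < eps.
Proof.
move=> /compact_near_coveringP/near_covering_withinP cC
  /within_continuousP cf Dy0 e0.
have e2 : 0 < eps / 2 by rewrite divr_gt0.
suff : \forall y \near y0, C `<=` (fun z => D y -> `|f z y0 - f z y| < eps).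
  by apply: filterS => y h Dy z Cz; exact: h.
apply: cC.
move=> z Cz; have [[A B] [nA nB] AB] := cf (z, y0) (conj Cz Dy0) _ e2.
exists (A, B) => // -[z' y] [/= Az' By] Cz' Dy.
rewrite (splitr eps) (le_lt_trans (ler_distD (f z y0) _ _))// ltrD//.
  rewrite distrC; apply: (AB (z', y0)) => //; split => //=.
  exact: nbhs_singleton.
exact: (AB (z', y)).
Qed.

Lemma within_continuous_flip (C : set S) (D : set T) (f : S -> T -> R) :
  {within C `*` D, continuous (fun p : S * T => f p.1 p.2)} ->
  {within D `*` C, continuous (fun p : T * S => f p.2 p.1)}.
Proof.
move=> /within_continuousP cf; apply/within_continuousP => -[y z] [/= Dy Cz] e e0.
have [[A B] [nA nB] AB] := cf (z, y) (conj Cz Dy) e e0.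
exists (B, A) => // -[y' z'] [/= By' Az'] [Dy' Cz'].
exact: (AB (z', y')).
Qed.

Lemma within_continuous_section (C : set S) (D : set T) (f : S -> T -> R) z :
  C z -> {within C `*` D, continuous (fun p : S * T => f p.1 p.2)} ->
  {within D, continuous (f z)}.
Proof.
move=> Cz cf; apply/within_continuousP => y Dy e e0.
have cz : compact [set z] by exact: compact_set1.
have cf' : {within [set z] `*` D, continuous (fun p : S * T => f p.1 p.2)}.
  by apply: continuous_subspaceW cf => -[a b] [/= -> ?].
by have := tube_near cz cf' Dy e0; apply: filterS => y' h Dy'; exact: h.
Qed.

End tube.

Lemma continuous_mdist {R : realType} {Y : pmetricType R} (c : Y) :
  continuous (mdist c : Y -> R).
Proof.
move=> x; apply/cvgrPdist_lt => e e0.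
have := nbhsx_ballx x e e0; apply: filterS => y; rewrite ballEmdist /= => xy.
rewrite ltr_norml; have h1 := metric_triangle c x y.
have h2 := metric_triangle c y x; rewrite (metric_sym y x) in h2.
by apply/andP; split; lra.
Qed.

(** * Integrals of bounded functions *)

Section bounded_integrals.
Context {R : realType} {d : measure_display} {Y : measurableType d}.
Variables (m : {finite_measure set Y -> \bar R}) (S : set Y).
Hypothesis mS : measurable S.

Lemma bounded_integrable (f : Y -> R) (B : R) : measurable_fun S f ->
  (forall x, S x -> `|f x| <= B) -> m.-integrable S (EFin \o f).
Proof.
move=> mf fB; apply: measurable_bounded_integrable => //.
  by rewrite ltey_eq fin_num_measure.
exists B; split; first exact: num_real.
by move=> x Bx y Sy /=; rewrite (le_trans (fB y Sy))// ltW.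
Qed.

Lemma Rintegral_close (f g : Y -> R) (eps : R) :
  m.-integrable S (EFin \o f) -> m.-integrable S (EFin \o g) ->
  (forall x, S x -> `|f x - g x| <= eps) ->
  `|\int[m]_(x in S) f x - \int[m]_(x in S) g x| <= eps * fine (m S).
Proof.
move=> fi gi fg; rewrite -RintegralB//.
have fgi : m.-integrable S (EFin \o (f \- g)).
  by have := integrableB mS fi gi; apply: eq_integrable => // x _ /=; rewrite EFinB.
rewrite (le_trans (le_normr_Rintegral mS fgi))// -Rintegral_cst//.
apply: le_Rintegral => //.
- exact: (integrable_norm fgi).
- apply: measurable_bounded_integrable => //.
    by rewrite ltey_eq fin_num_measure.
  exists `|eps|; split; first exact: num_real.
  by move=> x Bx y Sy /=; exact: ltW.
Qed.

End bounded_integrals.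

Lemma null_bigcup {R : realType} {d} {Y : measurableType d}
    (m : {measure set Y -> \bar R}) (F : nat -> set Y) :
  (forall k, measurable (F k)) -> (forall k, m (F k) = 0%E) ->
  m (\bigcup_k F k) = 0%E.
Proof.
move=> mF F0; apply: measure_negligible; first exact: bigcupT_measurable.
by apply: negligible_bigcup => k; exists (F k); split.
Qed.

Lemma integral_carried {R : realType} {T : ptopologicalType}
    (sigma : {finite_measure set (borel T) -> \bar R}) (C E : set (borel T))
    (f : T -> R) : compact (C : set T) -> measurable C -> measurable E ->
  E `<=` C -> sigma (~` E) = 0%E -> {within (C : set T), continuous f} ->
  (\int[sigma]_(p in E) (f p)%:E = \int[sigma]_(p in C) (f p)%:E)%E.
Proof.
move=> cC mC mE EC E0 cf.
have [M _ fM] := within_continuous_bounded cC cf.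
have mf := within_continuous_measurable cf.
have fi := @bounded_integrable _ _ _ sigma _ mC _ M mf fM.
have mCE : measurable (C `\` E) by exact: measurableD.
have CE0 : sigma (C `\` E) = 0%E.
  by apply: (subset_measure0 mCE (measurableC mE) _ E0) => p [].
by rewrite [RHS](negligible_integral mCE mC fi CE0) setDD setIidr.
Qed.

(** * Exchange of integrals for equicontinuous kernels *)

Section fubini_equicontinuous.
Context {R : realType} {X : ptopologicalType} {d : measure_display}
  {Z : measurableType d}.
Variables (mu : {finite_measure set (borel X) -> \bar R})
  (nu : {finite_measure set Z -> \bar R}).
Variables (S : set (borel X)) (A : set Z) (k : X -> Z -> R) (M : R).
Hypotheses (cS : compact (S : set X)) (mS : measurable S) (mA : measurable A).
Hypothesis mk : forall y, S y -> measurable_fun A (k y).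
Hypothesis kM : forall y z, S y -> A z -> `|k y z| <= M.
Hypothesis ke : forall e : R, 0 < e -> forall y : X, S y ->
  \forall y' \near y, S y' -> forall z, A z -> `|k y z - k y' z| <= e.

(** The approximating kernel takes finitely many values in the first variable:
    if y lies in the first neighbourhood of a finite cover that contains it, k y
    is replaced by its value at the centre. *)
Let approx (e : R) : 0 < e -> exists2 g : borel X * Z -> R,
  measurable_fun (S `*` A) g &
  forall y z, S y -> A z -> `|k y z - g (y, z)| <= e.
Proof.
move=> e0.
have [|s sS scov] := @compact_nbhs_cover X S
  (fun y => [set y' | S y' -> forall z, A z -> `|k y z - k y' z| <= e]^°) cS.
  by move=> y Sy; apply: nbhs_interior; exact: ke.
pose B y := [set y' | S y' -> forall z, A z -> `|k y z - k y' z| <= e]^°.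
pose g := fix g (l : seq X) (p : borel X * Z) : R :=
  if l is a :: l' then if `[< B a p.1 >] then k a p.2 else g l' p else 0.
exists (g s); last first.
  move=> y z Sy Az; have := scov y Sy; elim: s {sS scov} => [[]//|a l IH [c]] /=.
  case: asboolP => [Bay _ _|nBay].
    by rewrite distrC; exact: (interior_subset Bay).
  rewrite inE => /predU1P[->//|cl Bc]; apply: IH; by exists c.
elim: s sS {scov} => [_|a l IH sS] /=; first exact: measurable_cst.
have mSA : measurable (S `*` A) by exact: measurableX.
apply: measurable_fun_if => //.
- apply: (measurable_fun_bool true) => //=.
  rewrite (_ : _ @^-1` _ = (B a : set (borel X)) `*` setT).
    by apply: measurableI => //; apply: measurableX => //;
      apply: open_borel; exact: open_interior.
  by apply/seteqP; split => [p /= /asboolP|p [/= ? _]]; [|exact/asboolP].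
- have ma : measurable_fun (S `*` A) (fun p : borel X * Z => k a p.2).
    apply: (measurable_comp mA) => [_ [p [_ Ap] <-]//||]; last first.
      exact: measurable_funTS.
    by apply: mk; apply: sS; rewrite mem_head.
  apply: measurable_funS ma => //; exact: subIsetl.
- have ml := IH (fun x xl => sS x (mem_behead (s := a :: l) xl)).
  apply: measurable_funS ml => //; exact: subIsetl.
Qed.

(** k is a uniform limit of kernels that are piecewise constant in the first
    variable. *)
Let measurable_k : measurable_fun (S `*` A) (fun p : borel X * Z => k p.1 p.2).
Proof.
have ap (n : nat) : exists g : borel X * Z -> R, measurable_fun (S `*` A) g /\
    forall y z, S y -> A z -> `|k y z - g (y, z)| <= n.+1%:R^-1.
  by have [|g mg gk] := @approx n.+1%:R^-1; [rewrite invr_gt0|exists g].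
have [g /all_and2[mg gk]] := choice ap.
apply: (@measurable_fun_cvg _ _ _ _ g) => // -[y z] [Sy Az].
apply/cvgrPdist_le => e e0; near=> n.
rewrite (le_trans (gk n y z Sy Az))//; apply/ltW.
by near: n; exact: (near_infty_natSinv_lt (PosNum e0)).
Unshelve. all: end_near. Qed.

Let ereal_swap : (\int[mu]_(y in S) (\int[nu]_(z in A) (k y z)%:E) =
  \int[nu]_(z in A) (\int[mu]_(y in S) (k y z)%:E))%E.
Proof.
pose f : borel X * Z -> \bar R := (fun p => (k p.1 p.2)%:E) \_ (S `*` A).
have mSA : measurable (S `*` A) by exact: measurableX.
have fi : (mu \x nu)%E.-integrable setT f.
  pose kk (p : borel X * Z) : R := k p.1 p.2.
  have : (mu \x nu)%E.-integrable (S `*` A) (EFin \o kk).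
    apply: measurable_bounded_integrable; first exact: mSA.
    - suff : ((mu S * nu A)%E < +oo)%E by rewrite -product_measure1E.
      rewrite -[mu S]fineK ?fin_num_measure// -[nu A]fineK ?fin_num_measure//.
      by rewrite -EFinM ltry.
    - exact: measurable_k.
    - exists M; split; first exact: num_real.
      move=> x Mx [y z] [Sy Az]; exact: le_trans (kM Sy Az) (ltW Mx).
  by move/(@integrable_mkcond _ _ R (mu \x nu)%E (S `*` A) (EFin \o kk) mSA).
have := @Fubini _ _ _ _ _ mu nu f fi.
move=> h.
rewrite [LHS]integral_mkcond [RHS]integral_mkcond.
transitivity (\int[mu]_x \int[nu]_y f (x, y))%E.
  apply: eq_integral => y _; rewrite patchE; case: ifPn => [Sy|nSy].
    rewrite integral_mkcond; apply: eq_integral => z _.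
    rewrite /f !patchE; congr (if _ then _ else _).
    by rewrite in_setX Sy.
  by rewrite integral0_eq// => z _; rewrite /f patchE in_setX (negbTE nSy).
rewrite h; apply: eq_integral => z _; rewrite patchE; case: ifPn => [Az|nAz].
  rewrite [RHS]integral_mkcond; apply: eq_integral => y _.
  rewrite /f !patchE; congr (if _ then _ else _).
  by rewrite in_setX Az andbT.
by rewrite integral0_eq// => y _; rewrite /f patchE in_setX (negbTE nAz) andbF.
Qed.

Lemma Rintegral_swap_equicontinuous :
  \int[mu]_(y in S) \int[nu]_(z in A) k y z =
  \int[nu]_(z in A) \int[mu]_(y in S) k y z.
Proof.
have ki y : S y -> nu.-integrable A (EFin \o k y).
  move=> Sy; apply: measurable_bounded_integrable => //.
  - by rewrite ltey_eq fin_num_measure.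
  - exact: mk.
  - exists M; split; first exact: num_real.
    by move=> x Mx z Az; exact: le_trans (kM Sy Az) (ltW Mx).
have ki' z : A z -> mu.-integrable S (EFin \o k^~ z).
  move=> Az; apply: measurable_bounded_integrable => //.
  - by rewrite ltey_eq fin_num_measure.
  - apply: within_continuous_measurable; apply/within_continuousP => y Sy e e0.
    have := ke (divr_gt0 e0 (ltr0Sn R 1)) Sy; apply: filterS => y' h Sy'.
    by rewrite (le_lt_trans (h Sy' _ Az))// ltr_pdivrMr// ltr_pMr// ltr1n.
  - exists M; split; first exact: num_real.
    by move=> x Mx y Sy; exact: le_trans (kM Sy Az) (ltW Mx).
rewrite /Rintegral; congr fine; transitivity
    (\int[mu]_(y in S) \int[nu]_(z in A) (k y z)%:E)%E.
  apply: eq_integral => y /set_mem Sy; rewrite fineK//.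
  exact: integrable_fin_num (ki _ Sy).
rewrite ereal_swap; apply: eq_integral => z /set_mem Az; rewrite fineK//.
exact: integrable_fin_num (ki' _ Az).
Qed.

End fubini_equicontinuous.

(** * Weak sequential compactness of measures *)

Lemma pushforward_finite_measure {R : realType} {d d' : measure_display}
    {Y : measurableType d} {Z : measurableType d'}
    (nu : {finite_measure set Y -> \bar R}) (phi : Y -> Z) :
  measurable_fun setT phi ->
  exists nu' : {finite_measure set Z -> \bar R},
    (nu' : set Z -> \bar R) = pushforward nu phi.
Proof.
move=> mphi.
pose p : {measure set Z -> \bar R} :=
  measure_function_pushforward__canonical__measure_function_Measure nu mphi.
have pfin : (p setT < +oo)%E.
  by rewrite /= /pushforward preimage_setT ltey_eq fin_num_measure.
exists (mfrestr measurableT pfin : {finite_measure set Z -> \bar R}).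
by apply/funext => A; rewrite /= /mfrestr /mrestr setIT.
Qed.

Section coding.
Context {R : realType} {T : ptopologicalType} {I : countType}.
Variables (K : set T) (e : I -> T -> R).
Hypotheses (cK : compact K) (ce : forall i, continuous (e i)).
Hypothesis sep : forall x y, K x -> K y -> (forall i, e i x = e i y) -> x = y.

(** The bits of x compare the coordinates e i x with the rationals; the pairs
    (i, q) are enumerated by the naturals. *)
Definition bit (n : nat) (x : T) : bool :=
  if @unpickle (I * rat)%type n is Some iq then e iq.1 x < ratr iq.2 else false.

(** The most recent bit comes first, so that the word of length k is the tail
    of the word of length k + 1. *)
Fixpoint code (k : nat) (x : T) : seq bool :=
  if k is k'.+1 then bit k' x :: code k' x else [::].

Lemma size_code k x : size (code k x) = k.
Proof. by elim: k => //= k ->. Qed.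

Lemma code_bit k x y n : code k x = code k y -> (n < k)%N -> bit n x = bit n y.
Proof.
elim: k => // k IH /= [bxy cxy]; rewrite ltnS leq_eqVlt => /predU1P[->//|].
exact: IH.
Qed.

(** Two points separated by e i lie on either side of a rational q, so that the
    bit of (i, q) separates neighbourhoods of them. *)
Lemma separated_codes x y : K x -> K y -> x <> y ->
  exists n, (\forall x' \near x, bit n x' = bit n x) /\
            (\forall y' \near y, bit n y' = ~~ bit n x).
Proof.
move=> Kx Ky xy.
have [i exy] : exists i, e i x != e i y.
  apply: contrapT => /forallNP h; apply: xy; apply: sep => // i.
  by apply/eqP; have := h i => /negP; rewrite negbK.
wlog : x y Kx Ky xy exy / e i x < e i y.
  move=> wl; move: exy; rewrite neq_lt => /orP[h|h].
    by apply: (wl x y) => //; rewrite lt_eqF.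
  have [n [nx ny]] := wl y x Ky Kx (nesym xy) (negbT (lt_eqF h)) h.
  exists n; have bx : bit n x = ~~ bit n y by exact: nbhs_singleton ny.
  by rewrite bx negbK; split.
move=> exy'; have [q] := rat_in_itvoo exy'; rewrite in_itv/= => /andP[xq qy].
exists (pickle (i, q)).
have nx : \forall x' \near x, bit (pickle (i, q)) x'.
  rewrite /bit pickleK/=; near=> x'.
  by near: x'; exact: (@ce i x [set r | r < ratr q] (lt_nbhsl xq)).
have bx : bit (pickle (i, q)) x = true by exact: nbhs_singleton nx.
rewrite bx; split=> //.
rewrite /bit pickleK/=; near=> y'; apply/negbTE; rewrite -leNgt ltW//.
by near: y'; exact: (@ce i y [set r | ratr q < r] (lt_nbhsr qy)).
Unshelve. all: by end_near. Qed.

(** Near a pair of distinct points of K one bit tells the two points apart, and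
    near a diagonal pair the values of f are close; by compactness of K x K
    finitely many bits suffice. *)
Lemma code_oscillation (f : T -> R) (eps : R) : {within K, continuous f} ->
  0 < eps -> exists k, forall x y, K x -> K y -> code k x = code k y ->
    `|f x - f y| <= eps.
Proof.
move=> /within_continuousP cf e0.
have /compact_near_coveringP/near_covering_withinP cKK := compact_setX cK cK.
pose P (k : nat) (p : T * T) :=
  code k p.1 = code k p.2 -> `|f p.1 - f p.2| <= eps.
have [|N _ HN] := cKK nat \oo P _.
  move=> [x y] [/= Kx Ky]; have [<-|/eqP xy] := eqVneq x y.
    have h : \forall x' \near x, K x' -> `|f x - f x'| < eps / 2.
      by apply: cf => //; rewrite divr_gt0.
    exists ([set p : T * T | (K p.1 -> `|f x - f p.1| < eps / 2) /\
        (K p.2 -> `|f x - f p.2| < eps / 2)], setT) => /=.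
      split; last exact: filterT.
      exists ([set x' | K x' -> `|f x - f x'| < eps / 2],
        [set x' | K x' -> `|f x - f x'| < eps / 2]) => //=.
    move=> [[a b] k] [/= [fa fb] _] [Ka Kb] _ /=.
    rewrite (splitr eps) (le_trans (ler_distD (f x) _ _))// lerD// ltW//.
      by rewrite distrC; exact: fa.
    exact: fb.
  have [n [nx ny]] := separated_codes Kx Ky xy.
  exists ([set p : T * T | bit n p.1 = bit n x /\ bit n p.2 = ~~ bit n x],
     [set k | (n < k)%N]) => /=.
    split; last by exists n.+1.
    exists ([set x' | bit n x' = bit n x], [set x' | bit n x' = ~~ bit n x]) => //=.
  move=> [[a b] k] [/= [ba bb] nk] _ /= cab.
  by have := code_bit cab nk; rewrite ba bb; case: (bit n x).
exists N => x y Kx Ky; exact: (HN N (leqnn N) (x, y)).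
Qed.

End coding.

(** The subsequence follows a cluster point supplied by Tychonoff's theorem: at
    step k the coordinates of rank at most k are within 1/(k+1) of it. *)
Lemma diagonal_subsequence {R : realType} {J : countType} (v : nat -> J -> R)
    (M : R) : (forall n s, 0 <= v n s <= M) ->
  exists2 phi : nat -> nat, {homo phi : m n / (m < n)%N} &
    exists c : J -> R, forall s, v (phi n) s @[n --> \oo] --> c s.
Proof.
move=> vM.
have [|c [_ clc]] := @tychonoff J (fun=> R) (fun=> `[0, M]%classic)
  (fun=> @segment_compact R 0 M) (v @ \oo).
  by exists 0 => // n _ /= s; rewrite in_itv/=; exact: vM.
have close (l : seq J) (eps : R) : 0 < eps ->
    \forall g \near c, forall s, s \in l -> `|c s - g s| < eps.
  move=> e0; elim: l => [|a l IH]; first by near=> g.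
  have na : \forall g \near c, `|c a - g a| < eps.
    exact: (@proj_continuous J (fun=> R) a c (ball (c a) eps) (nbhsx_ballx _ _ e0)).
  near=> g => s; rewrite inE => /predU1P[->|sl]; first by near: g.
  by move: s sl; near: g.
have next (k N : nat) : exists n, (N <= n)%N /\ forall s : J,
    (pickle s <= k)%N -> `|c s - v n s| < k.+1%:R^-1.
  have e0 : 0 < k.+1%:R^-1 :> R by rewrite invr_gt0.
  have := close (pmap unpickle (iota 0 k.+1)) _ e0.
  move=> /(clc [set v n | n in [set n | (N <= n)%N]]) [].
    by exists N => // n Nn; exists n.
  move=> _ [[n Nn <-]] h; exists n; split => // s sk; apply: h.
  by rewrite mem_pmap; apply/mapP; exists (pickle s); rewrite ?mem_iota ?pickleK.
pose F k := projT1 (choice (next k)); have HF k := projT2 (choice (next k)).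
pose phi := fix phi k := if k is k'.+1 then F k (phi k').+1 else F 0%N 0%N.
exists phi.
  by apply: homo_ltn; [exact: ltn_trans|move=> k; have [] := HF k.+1 (phi k).+1].
exists c => s; apply/cvgrPdist_lt => eps e0; near=> n.
have sn : `|c s - v (phi n) s| < n.+1%:R^-1.
  have ns : (pickle s <= n)%N by near: n; exists (pickle s).
  by case: (n) ns => [|m] ns; [have [_] := HF 0%N 0%N|have [_] := HF m.+1 (phi m).+1]; exact.
rewrite (lt_trans sn)//.
by near: n; exact: (near_infty_natSinv_lt (PosNum e0)).
Unshelve. all: by end_near. Qed.

Lemma Rintegral_word {R : realType} {d} {Y : measurableType d}
    (m : {finite_measure set Y -> \bar R}) (S : set Y) (k : nat)
    (w : Y -> seq bool) (F : seq bool -> R) :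
  measurable S -> (forall x, S x -> size (w x) = k) ->
  (forall s, measurable (S `&` [set x | w x = s])) ->
  measurable_fun S (F \o w) /\
  \int[m]_(x in S) F (w x) =
  \sum_(s : k.-tuple bool) F s * fine (m (S `&` [set x | w x = s])).
Proof.
move=> mS sw mw.
pose g (s : k.-tuple bool) (x : Y) : R := F s * \1_(S `&` [set x | w x = s]) x.
have mg s : measurable_fun setT (g s).
  by apply: measurable_funM => //; exact: measurable_indic.
have FE x : S x -> F (w x) = \sum_(s : k.-tuple bool) g s x.
  move=> Sx; have kw : size (w x) == k by rewrite sw.
  rewrite (bigD1 (Tuple kw))//= big1 ?addr0 => [|s sne].
    by rewrite /g indicE mem_set ?mulr1.
  rewrite /g indicE memNset ?mulr0// => -[_ /= ws].
  by move: sne; rewrite -val_eqE/= ws eqxx.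
split.
  apply: (eq_measurable_fun (fun x => \sum_(s : k.-tuple bool) g s x)).
    by move=> x /set_mem Sx; rewrite -FE.
  by apply: measurable_sum => s; exact: measurable_funTS.
rewrite (@eq_Rintegral _ _ _ _ _ (fun x => \sum_(s : k.-tuple bool) g s x)); last first.
  by move=> x /set_mem Sx; rewrite FE.
have gi s : m.-integrable S (EFin \o g s).
  apply: measurable_bounded_integrable => //.
  - by rewrite ltey_eq fin_num_measure.
  - exact: measurable_funTS.
  - exists `|F s|; split; first exact: num_real.
    move=> x Mx y _ /=; rewrite (le_trans _ (ltW Mx))// /g normrM.
    by rewrite ler_piMr// indicE; case: (_ \in _); rewrite ?normr1 ?normr0.
rewrite /Rintegral.
under eq_integral do rewrite -sumEFin.
rewrite integral_sum//.
rewrite (eq_bigr (fun s => (Rintegral m S (g s))%:E)); last first.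
  by move=> s _; rewrite /Rintegral fineK//; apply: integrable_fin_num (gi s).
rewrite sumEFin/=; apply: eq_bigr => s _.
rewrite RintegralZl//; last first.
  apply: measurable_bounded_integrable => //.
  - by rewrite ltey_eq fin_num_measure.
  - exists 1; split; first exact: num_real.
    move=> x Mx y _ /=; rewrite (le_trans _ (ltW Mx))//.
    by rewrite indicE; case: (_ \in _); rewrite ?normr1 ?normr0.
by rewrite /Rintegral integral_indic//= setIAC setIid.
Qed.

Section weak_compactness.
Context {R : realType} {T : ptopologicalType} {I : countType}.
Variables (K : set T) (e : I -> T -> R) (k0 : T).
Hypotheses (cK : compact K) (clK : closed K) (Kk0 : K k0).
Hypothesis ce : forall i, continuous (e i).
Hypothesis sep : forall x y, K x -> K y -> (forall i, e i x = e i y) -> x = y.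
Variables (M : R) (mu : nat -> {finite_measure set (borel T) -> \bar R}).
Hypotheses (muK : forall n, mu n (~` K) = 0%E).
Hypotheses (muM : forall n, mu n setT = M%:E).

Local Notation code := (code e).

Let mK : measurable (K : set (borel T)).
Proof. exact: closed_borel. Qed.

Let M0 : 0 <= M.
Proof. by rewrite -lee_fin -(muM 0). Qed.

Let cyl (s : seq bool) : set (borel T) := K `&` [set x | code (size s) x = s].

Let muKM n : mu n K = M%:E.
Proof.
have mKC : measurable (~` K : set (borel T)) by exact: measurableC mK.
rewrite -(muM n) -(setUv K) [RHS]measureU//; last by rewrite setICr.
by rewrite [X in _ = (_ + X)%E](_ : _ = 0%E) ?adde0//; exact: muK.
Qed.

Let measurable_bit n : measurable ([set x | bit e n x] : set (borel T)).
Proof.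
rewrite /bit; case: unpickle => [[i q]|]/=; last first.
  by rewrite (_ : [set _ | _] = set0)//; apply/seteqP; split.
apply: open_borel; have /continuousP := @ce i.
by move=> /(_ [set r | r < ratr q]); apply; exact: open_lt.
Qed.

Let measurable_code k s : measurable ([set x | code k x = s] : set (borel T)).
Proof.
elim: k s => [|k IH] [|b s] /=.
- by rewrite (_ : [set _ | _] = setT)//; apply/seteqP; split.
- by rewrite (_ : [set _ | _] = set0)//; apply/seteqP; split.
- by rewrite (_ : [set _ | _] = set0)//; apply/seteqP; split.
rewrite (_ : [set _ | _] = [set x | bit e k x = b] `&` [set x | code k x = s]).
  apply: measurableI => //; case: b; first exact: measurable_bit.
  rewrite (_ : [set _ | _] = ~` [set x | bit e k x]).
    by apply: measurableC; exact: measurable_bit.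
  by apply/seteqP; split => x /=; case: (bit e k x).
by apply/seteqP; split => [x /= [-> ->]//|x /= [-> ->]].
Qed.

Let mcyl s : measurable (cyl s).
Proof. by apply: measurableI => //; exact: measurable_code. Qed.

Let v n s : R := fine (mu n (cyl s)).

Let vM n s : 0 <= v n s <= M.
Proof.
have fin : mu n (cyl s) \is a fin_num.
  by apply: fin_num_measure; exact: mcyl.
rewrite fine_ge0//= -lee_fin fineK//.
by rewrite -(muKM n); apply: le_measure; rewrite ?inE;
  [exact: mcyl|exact: mK|exact: subIsetl].
Qed.

Section limit_measure.
Variables (phi : nat -> nat) (c : seq bool -> R).
Hypothesis vc : forall s, v (phi n) s @[n --> \oo] --> c s.

Let c_ge0 s : 0 <= c s.
Proof.
rewrite -(cvg_lim _ (@vc s))//; apply: limr_ge.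
  by apply: cvgP; exact: vc.
by near=> n; case/andP: (vM (phi n) s).
Unshelve. all: by end_near. Qed.

Let c_unique s (r : R) : v (phi n) s @[n --> \oo] --> r -> c s = r.
Proof. by move=> h; rewrite -(cvg_lim _ (@vc s))// (cvg_lim _ h). Qed.

Let c_nil : c [::] = M.
Proof.
apply: c_unique; apply: cvg_near_cst; near=> n; rewrite /v (_ : cyl _ = K) ?muKM//.
by rewrite /cyl/= (_ : [set _ | _] = setT) ?setIT//; apply/seteqP; split.
Unshelve. all: by end_near. Qed.

Let c_cons s : c s = c (false :: s) + c (true :: s).
Proof.
have vS n : v n s = v n (false :: s) + v n (true :: s).
  rewrite /v -fineD ?fin_num_measure//; try exact: mcyl.
  congr fine; rewrite -measureU//; try exact: mcyl; last first.
    apply/seteqP; split => // x [[_ /= [b0 _]] [_ /= [b1 _]]].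
    by rewrite b0 in b1.
  congr (mu n _); apply/seteqP; split => x /=.
    by move=> [Kx xs]; case bx: (bit e (size s) x);
      [right|left]; split; rewrite //= xs bx.
  by move=> [] [Kx [_ xs]].
apply: c_unique; under eq_fun do rewrite vS.
by apply: cvgD; exact: vc.
Qed.

Let c_cyl s : 0 < c s -> cyl s !=set0.
Proof.
move=> cs; apply/set0P/negP => /eqP s0.
have c0 : c s = 0.
  by apply: c_unique; apply: cvg_near_cst; near=> n; rewrite /v s0 measure0.
by rewrite c0 ltxx in cs.
Unshelve. all: by end_near. Qed.

(** The words of length k cut [0, M[ into consecutive intervals, the one of s
    having length c s and left end l s. *)
Let l := fix l (s : seq bool) : R :=
  if s is b :: s' then l s' + (if b then c (false :: s') else 0) else 0.
(** The word of length k whose interval contains t: the next bit is true when t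
    lies beyond the part of the current interval that belongs to the extension
    by false. *)
Let w := fix w (k : nat) (t : R) : seq bool :=
  if k is k'.+1 then (l (w k' t) + c (false :: w k' t) <= t) :: w k' t else [::].

Let J : set (g_sigma_algebraType (R.-ocitv.-measurable)) := `[0, M[%classic.

Let size_w k t : size (w k t) = k.
Proof. by elim: k => //= k ->. Qed.

Let w_level s t : J t -> (w (size s) t = s) <-> l s <= t < l s + c s.
Proof.
rewrite /J/= in_itv/=; elim: s => [|b s IH] Jt /=.
  by rewrite c_nil add0r; split.
have {}IH := IH Jt; split.
  move=> [wb ws]; move: wb; rewrite ws; move/IH: ws => /andP[lt1 lt2].
  rewrite (c_cons s) in lt2; case: b => [lt|/negbT].
    by rewrite lt/= -addrA.
  by rewrite -ltNge addr0 lt1 => ->.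
case: b => /andP[lt1 lt2].
  have ws : w (size s) t = s.
    apply/IH; rewrite (c_cons s) addrA lt2 andbT (le_trans _ lt1)//.
    by rewrite lerDl c_ge0.
  by rewrite ws lt1.
rewrite addr0 in lt1 lt2.
have ws : w (size s) t = s.
  by apply/IH; rewrite lt1 (c_cons s) addrA (lt_le_trans lt2)// lerDl c_ge0.
by rewrite ws leNgt lt2.
Qed.

Let c_w k t : J t -> 0 < c (w k t).
Proof.
move=> Jt; have /(w_level _ Jt)/andP[h1 h2] : w (size (w k t)) t = w k t.
  by rewrite size_w.
by rewrite -(ltrDl (l (w k t))); exact: le_lt_trans h2.
Qed.

Let pt (s : seq bool) : T := xget k0 (cyl s).

Let cyl_pt k t : J t -> cyl (w k t) (pt (w k t)).
Proof. by move=> /(c_w k)/c_cyl[x ?]; apply: xgetPex; exists x. Qed.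

Let code_pt k k' t : J t -> (k <= k')%N -> code k (pt (w k' t)) = w k t.
Proof.
move=> Jt kk'; have [_ /=] := cyl_pt k' Jt; rewrite size_w.
move: (pt _) => x; rewrite -(subnK kk'); elim: (k' - k)%N => // n IH.
by rewrite addSn /= => -[_ /IH].
Qed.

(** The points pt (w k t) have a cluster point in K. It is their limit along
    every continuous f, since by [code_oscillation] the values of f at these
    points form a Cauchy sequence. Off [0, M[ a constant point is chosen. *)
Let limit_point (t : R) : exists z, [/\ K z, ~ J t -> z = k0 & (J t ->
  forall (f : T -> R) (eps : R) k, {within K, continuous f} ->
    (forall x y, K x -> K y -> code k x = code k y -> `|f x - f y| <= eps) ->
    `|f z - f (pt (w k t))| <= eps)].
Proof.
have [Jt|nJ] := pselect (J t); last by exists k0.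
have [|z [Kz clz]] := cK (F := (fun k => pt (w k t)) @ \oo) _.
  by exists 0 => // k _ /=; have [] := cyl_pt k Jt.
exists z; split => // _ f eps k /within_continuousP cf osc.
apply/ler_addgt0Pr => d d0.
have [||y [[k' kk' <-] fy]] := clz [set pt (w k' t) | k' in [set k' | (k <= k')%N]]
    [set y | K y -> `|f z - f y| < d].
- by exists k => // k' kk'; exists k'.
- exact: cf.
have [Kp _] := cyl_pt k Jt; have [Kp' _] := cyl_pt k' Jt.
rewrite (le_trans (ler_distD (f (pt (w k' t))) _ _))// addrC lerD//.
  by apply: osc => //; rewrite !code_pt.
by apply/ltW/fy.
Qed.

Let Phi (t : g_sigma_algebraType (R.-ocitv.-measurable)) : borel T :=
  projT1 (cid (limit_point t)).

Let K_Phi t : K (Phi t).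
Proof. by rewrite /Phi; case: cid => z []. Qed.

Let Phi_out t : ~ J t -> Phi t = k0.
Proof. by rewrite /Phi; case: cid => z []. Qed.

Let Phi_pt t (f : T -> R) (eps : R) k : J t -> {within K, continuous f} ->
    (forall x y, K x -> K y -> code k x = code k y -> `|f x - f y| <= eps) ->
    `|f (Phi t) - f (pt (w k t))| <= eps.
Proof. by rewrite /Phi; case: cid => z /= [_ _ h] Jt; exact: h. Qed.

Let mJ : measurable J. Proof. exact: measurable_itv. Qed.

Let measurable_w s k : measurable (J `&` [set t | w k t = s]).
Proof.
have [<-|sk] := eqVneq (size s) k; last first.
  rewrite (_ : _ `&` _ = set0)//; apply/seteqP; split => // t [_ /= ws].
  by move: sk; rewrite -ws size_w eqxx.
rewrite (_ : _ `&` _ = J `&` `[l s, l s + c s[%classic).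
  by apply: measurableI => //; exact: measurable_itv.
by apply/seteqP; split => t [Jt /(w_level _ Jt)].
Qed.

Let measurable_continuous_Phi (f : T -> R) : {within K, continuous f} ->
  measurable_fun J (f \o Phi).
Proof.
move=> cf; apply: (@measurable_fun_cvg _ _ _ _ (fun k t => f (pt (w k t)))).
  move=> k; have lebJ : (@lebesgue_measure R J < +oo)%E.
    by rewrite /J lebesgue_measure_itv/=; case: ifP => _; rewrite ?ltry.
  by have [] := @Rintegral_word _ _ _ (mfrestr mJ lebJ) J k (w k) (f \o pt) mJ
    (fun t _ => size_w k t) (fun s => measurable_w s k).
move=> t Jt; apply/cvgrPdist_le => eps e0.
have [k osc] := code_oscillation cK ce sep cf e0.
exists k => // k' /= kk'; apply: Phi_pt => // x y Kx Ky xy; apply: osc => //.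
elim: k' kk' xy => [|k' IH]; first by rewrite leqn0 => /eqP ->.
by rewrite leq_eqVlt => /predU1P[->//|/IH h /= [_ /h]].
Qed.

(** The part of K outside an open neighbourhood of x is compact, so finitely
    many bits separate it from x. Hence open sets pull back under Phi to
    countable unions of sets defined by finitely many bits. *)
Let open_code (O : set T) x : open O -> K x -> O x ->
  exists k, forall y, K y -> code k y = code k x -> O y.
Proof.
move=> oO Kx Ox.
have cKO : compact (K `&` ~` O).
  by apply: compact_closedI => //; exact: open_closedC.
have /compact_near_coveringP/near_covering_withinP cov := cKO.
have [|N _ HN] := cov nat \oo (fun k y => code k y <> code k x) _.
  move=> y [Ky nOy]; have xy : x <> y by move=> xy; rewrite xy in Ox.
  have [n [nx ny]] := separated_codes ce sep Kx Ky xy.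
  exists ([set y' | bit e n y' = ~~ bit e n x], [set k | (n < k)%N]) => /=.
    by split => //; exists n.+1.
  move=> [y' k] [/= by' nk] _ cyx.
  by have := code_bit cyx nk; rewrite by'; case: (bit e n x).
exists N => y Ky cyx; apply: contrapT => nOy.
by apply: (HN N (leqnn N) y).
Qed.

Let measurable_code_Phi k s : measurable (J `&` [set t | code k (Phi t) = s]).
Proof.
have mbit n : measurable (J `&` [set t | bit e n (Phi t)]).
  rewrite /bit; case: unpickle => [[i q]|]/=; last first.
    by rewrite (_ : [set _ | _] = set0) ?setI0//; apply/seteqP; split.
  have /measurable_continuous_Phi : {within K, continuous (e i)}.
    by apply: continuous_subspaceT => ?; exact: ce.
  by move=> /(_ mJ [set r | r < ratr q]); apply; apply: open_measurable; exact: open_lt.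
elim: k s => [|k IH] [|b s] /=.
- by rewrite (_ : [set _ | _] = setT) ?setIT//; apply/seteqP; split.
- by rewrite (_ : [set _ | _] = set0) ?setI0//; apply/seteqP; split.
- by rewrite (_ : [set _ | _] = set0) ?setI0//; apply/seteqP; split.
rewrite (_ : _ `&` _ = (J `&` [set t | bit e k (Phi t) = b]) `&`
    (J `&` [set t | code k (Phi t) = s])).
  apply: measurableI => //; case: b; first exact: mbit.
  rewrite (_ : _ `&` _ = J `\` (J `&` [set t | bit e k (Phi t)])).
    by apply: measurableD => //; exact: mbit.
  apply/seteqP; split => t /= [Jt]; first by move=> ->; split => // -[].
  by move=> h; split => //; apply/negP => bt; apply: h.
by apply/seteqP; split => [t /= [Jt [-> ->]]|t /= [[Jt ->] [_ ->]]].
Qed.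

Let measurable_Phi : measurable_fun setT Phi.
Proof.
have sub : preimage_set_system setT Phi (@open T) `<=` measurable; last first.
  exact: (@measurability _ _ _ (borel T) setT Phi (@open T) erefl sub).
move=> _ [U oU <-].
rewrite setTI (_ : _ @^-1` _ = (J `&` Phi @^-1` U) `|` (~` J `&` Phi @^-1` U)).
  apply: measurableU.
    pose F (n : nat) := if @unpickle (seq bool) n is Some s then
      if `[< forall y, K y -> code (size s) y = s -> U y >]
      then J `&` [set t | code (size s) (Phi t) = s] else set0 else set0.
    rewrite (_ : _ `&` _ = \bigcup_n F n).
      apply: bigcupT_measurable => n; rewrite /F; case: unpickle => // s.
      by case: ifP => // _; exact: measurable_code_Phi.
    apply/seteqP; split => [t [Jt Ut]|t [n _]].
      have [k Hk] := open_code oU (K_Phi t) Ut.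
      exists (pickle (code k (Phi t))) => //; rewrite /F pickleK size_code.
      by rewrite ifT//; apply/asboolP.
    rewrite /F; case: unpickle => // s; case: asboolP => // h [Jt /= ct].
    by split => //; exact: h.
  have [Uk0|nUk0] := pselect (U k0).
    rewrite (_ : _ `&` _ = ~` J); first exact: measurableC mJ.
    by apply/seteqP; split => [t []//|t Jt]; split => //=; rewrite Phi_out.
  rewrite (_ : _ `&` _ = set0)//.
  by apply/seteqP; split => // t [nJ /=]; rewrite Phi_out.
by rewrite -setIUl setUv setTI.
Qed.

Let lebJ : @lebesgue_measure R J = M%:E.
Proof.
rewrite /J lebesgue_measure_itv/= lte_fin; case: ifPn => [_|].
  by rewrite -EFinD subr0.
by rewrite -leNgt => M_le0; congr EFin; apply/eqP; rewrite eq_le M0 M_le0.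
Qed.

Let lebJfin : (@lebesgue_measure R J < +oo)%E.
Proof. by rewrite lebJ ltry. Qed.

Let nu : {finite_measure set _ -> \bar R} := mfrestr mJ lebJfin.

Let l_bounds s : 0 <= l s /\ l s + c s <= M.
Proof.
elim: s => [|b s [l0 lM]] /=; first by rewrite add0r c_nil.
rewrite (c_cons s) in lM; case: b.
  by rewrite addr_ge0//= -addrA.
by rewrite addr0; split => //; rewrite (le_trans _ lM)// lerD2l lerDl.
Qed.

Let nu_w k (s : k.-tuple bool) : nu (J `&` [set t | w k t = s]) = (c s)%:E.
Proof.
rewrite /nu/= /mfrestr /mrestr.
have [l0 lM] := l_bounds s.
rewrite (_ : _ `&` J = `[l s, l s + c s[%classic).
  rewrite lebesgue_measure_itv/= lte_fin ltrDl; case: ifPn => [_|].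
    by rewrite -EFinD addrAC subrr add0r.
  by rewrite -leNgt => cs; congr EFin; apply/eqP; rewrite eq_le c_ge0 cs.
have kE : k = size s by rewrite size_tuple.
apply/seteqP; split => t /=.
  by move=> [[Jt]]; rewrite {1}kE => /(w_level _ Jt) + _; rewrite in_itv.
rewrite in_itv/= => /andP[lt tl].
have Jt : J t.
  by rewrite /J/= in_itv/= (le_trans l0 lt) (lt_le_trans tl lM).
by split => //; split => //; rewrite {1}kE; apply/w_level => //; rewrite lt.
Qed.

Let nu_J : nu J = M%:E.
Proof. by rewrite /nu/= /mfrestr /mrestr setIid lebJ. Qed.

Let integrable_mu n (f : T -> R) : {within K, continuous f} ->
  (mu n).-integrable (K : set (borel T)) (EFin \o f).
Proof.
move=> cf; have [B _ fB] := within_continuous_bounded cK cf.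
exact: bounded_integrable (within_continuous_measurable cf) fB.
Qed.

Let integrable_Phi (f : T -> R) : {within K, continuous f} ->
  nu.-integrable J (EFin \o (f \o Phi)).
Proof.
move=> cf; have [B _ fB] := within_continuous_bounded cK cf.
by apply: (@bounded_integrable _ _ _ _ _ _ _ B) => // [|t _];
  [exact: measurable_continuous_Phi|apply: fB; exact: K_Phi].
Qed.

(** Both integrals are compared with the sum over words of length k of f at a
    point of the word times the mass of the word, which converges because the
    masses do. *)
Let cvg_integral (f : T -> R) : {within K, continuous f} ->
  \int[mu (phi n)]_(x in (K : set (borel T))) f x @[n --> \oo] -->
  \int[nu]_(t in J) f (Phi t).
Proof.
move=> cf; apply/cvgrPdist_le => eps e0.
pose d := eps / (2 * M + 1).
have M1 : 0 < 2 * M + 1 by rewrite ltr_wpDl// mulr_ge0.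
have d0 : 0 < d by rewrite divr_gt0.
have [k osc] := code_oscillation cK ce sep cf d0.
have [B _ fB] := within_continuous_bounded cK cf.
have Kpt t : J t -> K (pt (w k t)) by move=> Jt; have [] := cyl_pt k Jt.
have cylx x : K x -> cyl (code k x) (pt (code k x)).
  by move=> Kx; apply: xgetPex; exists x; split => //=; rewrite size_code.
have [mw iw] := Rintegral_word nu (f \o pt) mJ
  (fun t _ => size_w k t) (fun s => measurable_w s k).
have nuE : `|\int[nu]_(t in J) f (Phi t) -
    \sum_(s : k.-tuple bool) f (pt s) * c s| <= d * M.
  rewrite (_ : \sum_(s : k.-tuple bool) _ = \int[nu]_(t in J) f (pt (w k t))).
    have nJM : fine (nu J) = M by rewrite nu_J.
    rewrite -[in d * M]nJM; apply: Rintegral_close => //.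
    - exact: integrable_Phi.
    - by apply: (@bounded_integrable _ _ _ nu _ mJ _ B mw) => t Jt; exact/fB/Kpt.
    - by move=> t Jt; exact: Phi_pt.
  by rewrite iw; apply: eq_bigr => s _; rewrite nu_w.
have muE n : `|\int[mu n]_(x in (K : set (borel T))) f x -
    \sum_(s : k.-tuple bool) f (pt s) * v n s| <= d * M.
  have [mc ic] := Rintegral_word (mu n) (f \o pt) mK (fun x _ => size_code e k x)
    (fun s => measurableI _ _ mK (measurable_code k s)).
  rewrite (_ : \sum_(s : k.-tuple bool) _ =
      \int[mu n]_(x in (K : set (borel T))) f (pt (code k x))).
    have muM' : fine (mu n K) = M by rewrite muKM.
    rewrite -[in d * M]muM'; apply: Rintegral_close => //.
    - exact: integrable_mu.
    - by apply: (@bounded_integrable _ _ _ (mu n) _ mK _ B mc) => x /cylx[Kx _]; exact: fB.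
    - move=> x Kx; have [Kp /= cp] := cylx x Kx.
      by apply: osc => //; move: cp; rewrite size_code.
  by rewrite ic; apply: eq_bigr => s _; rewrite /v /cyl size_tuple.
have sumc : \sum_(s : k.-tuple bool) f (pt s) * v (phi n) s @[n --> \oo] -->
    \sum_(s : k.-tuple bool) f (pt s) * c s.
  apply: cvg_big => [|s _]; first exact: add_continuous.
  by apply: cvgM; [exact: cvg_cst|exact: vc].
near=> n.
have sn : `|\sum_(s : k.-tuple bool) f (pt s) * c s -
    \sum_(s : k.-tuple bool) f (pt s) * v (phi n) s| <= d.
  by near: n; move/cvgrPdist_le : sumc; exact.
have -> : eps = d * M + (d + d * M) by rewrite /d; field; rewrite gt_eqF.
rewrite (le_trans (ler_distD (\sum_(s : k.-tuple bool) f (pt s) * c s) _ _))//.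
rewrite lerD//.
rewrite (le_trans (ler_distD (\sum_(s : k.-tuple bool) f (pt s) * v (phi n) s) _ _))//.
by rewrite lerD// distrC.
Unshelve. all: by end_near. Qed.

(** The limit is the image under Phi of Lebesgue measure on [0, M[. *)
Lemma weak_limit_of_masses : exists Lam : {finite_measure set (borel T) -> \bar R},
  carried_by Lam (K : set (borel T)) /\ weak_cvg K (mu \o phi) Lam.
Proof.
have [Lam LamE] := pushforward_finite_measure nu measurable_Phi.
exists Lam; split.
  split => //; rewrite LamE /pushforward (_ : _ @^-1` _ = set0) ?measure0//.
  by apply/seteqP; split => // t /=; apply; exact: K_Phi.
move=> f cf; rewrite LamE.
have fin n : (\int[mu n]_(x in (K : set (borel T))) (f x)%:E)%E \is a fin_num.
  exact: integrable_fin_num (integrable_mu n cf).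
have -> : (\int[pushforward nu Phi]_(x in (K : set (borel T))) (f x)%:E =
    (\int[nu]_(t in J) f (Phi t))%:E)%E.
  have mf : measurable_fun setT (EFin \o f \_ (K : set (borel T))).
    apply/measurable_EFinP; apply/(measurable_restrictT _ mK).
    exact: within_continuous_measurable.
  have nuJC : nu (~` J) = 0%E by rewrite /nu/= /mfrestr /mrestr setICl measure0.
  rewrite integral_mkcond.
  rewrite (_ : _ \_ _ = EFin \o f \_ (K : set (borel T))); last exact: restrict_EFin.
  have intT : nu.-integrable setT ((EFin \o f \_ (K : set (borel T))) \o Phi).
    have [B B0 fB] := within_continuous_bounded cK cf.
    apply: (@bounded_integrable _ _ _ nu _ _ _ B) => //.
      apply: (measurableT_comp _ measurable_Phi); exact/measurable_EFinP.
    by move=> t _; rewrite /= patchE mem_set; [exact/fB/K_Phi|exact: K_Phi].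
  rewrite (integral_pushforward measurable_Phi mf)//.
  rewrite preimage_setT (negligible_integral (N := ~` J)) //; last exact: measurableC.
  rewrite setTD setCK /Rintegral fineK; last exact: integrable_fin_num (integrable_Phi cf).
  apply: eq_integral => t _ /=; rewrite patchE mem_set//; exact: K_Phi.
apply: cvg_EFin; last exact: cvg_integral cf.
by near=> n; exact: fin.
Unshelve. all: by end_near. Qed.

End limit_measure.

Theorem weak_sequential_compactness :
  exists2 phi : nat -> nat, {homo phi : m n / (m < n)%N} &
    exists Lam : {finite_measure set (borel T) -> \bar R},
      carried_by Lam (K : set (borel T)) /\ weak_cvg K (mu \o phi) Lam.
Proof.
have [phi phi_lt [c vc]] := diagonal_subsequence vM.
by exists phi => //; exact: (@weak_limit_of_masses phi c vc).
Qed.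

End weak_compactness.

(** * Densities on compact sets and their images *)

Section density_measure.
Local Open Scope charge_scope.
Context {R : realType} {T : ptopologicalType}.
Variables (mu : {finite_measure set (borel T) -> \bar R}) (S : set (borel T))
  (f : T -> R).
Hypotheses (mS : measurable S) (f_ge0 : forall x, S x -> 0 <= f x).
Hypothesis fi : mu.-integrable S (EFin \o f).

Let g : borel T -> \bar R := (EFin \o f) \_ S.

Let g_ge0 x : (0 <= g x)%E.
Proof. by rewrite /g patchE; case: ifPn => // /set_mem /f_ge0; rewrite lee_fin. Qed.

Let gi : mu.-integrable setT g.
Proof. by move/(integrable_mkcond _ mS) : fi. Qed.

Let densityE : density mu S f = (fun A => \int[mu]_(x in A) g x)%E.
Proof. by apply/funext => A; rewrite /density integral_mkcondr. Qed.

Let density0 : density mu S f set0 = 0%E.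
Proof. by rewrite densityE integral_set0. Qed.

Let density_ge0 A : (0 <= density mu S f A)%E.
Proof. by rewrite densityE; apply: integral_ge0. Qed.

Let density_sigma_additive : semi_sigma_additive (density mu S f).
Proof.
rewrite densityE; apply: semi_sigma_additive_nng_induced => //.
exact: measurable_int gi.
Qed.

HB.instance Definition _ := isMeasure.Build _ _ _ (density mu S f)
  density0 density_ge0 density_sigma_additive.

(** The integration formula is the change of variables of the Radon-Nikodym
    theorem, the derivative being almost everywhere equal to f. *)
Lemma density_finite_measure : exists2 lam : {finite_measure set (borel T) -> \bar R},
  (lam : set (borel T) -> \bar R) = density mu S f &
  forall h : T -> R, lam.-integrable S (EFin \o h) ->
    (\int[lam]_(x in S) (h x)%:E = \int[mu]_(x in S) (h x * f x)%:E)%E.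
Proof.
have fin : (density mu S f setT < +oo)%E.
  by rewrite densityE; exact: (integrable_lty (measurableT) gi).
pose lam : {finite_measure set (borel T) -> \bar R} := mfrestr measurableT fin.
have lamE : (lam : set (borel T) -> \bar R) = density mu S f.
  by apply/funext => A; rewrite /= /mfrestr /mrestr setIT.
exists lam => // h hi.
have dom : lam `<< mu.
  move=> N nN A mA AN; rewrite lamE densityE.
  have A0 : mu A = 0%E by exact: nN.
  apply: null_set_integral => //.
  by apply: measurable_funTS; exact: measurable_int gi.
rewrite -(Radon_Nikodym_change_of_variables dom mS hi).
have RNi : mu.-integrable setT ('d (charge_of_finite_measure lam) '/d mu).
  exact: Radon_Nikodym_integrable.
have ae : ae_eq mu setT ('d (charge_of_finite_measure lam) '/d mu) g.
  apply: integral_ae_eq => //; first exact: measurable_int gi.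
  move=> A _ mA; rewrite -Radon_Nikodym_integral//=.
  by rewrite /lam /mfrestr /mrestr setIT densityE.
have mh := measurable_int _ hi.
apply: ae_eq_integral => //.
- by apply: emeasurable_funM => //; apply: measurable_funTS; exact: measurable_int RNi.
- apply/measurable_EFinP; apply: measurable_funM; apply/measurable_EFinP => //.
  exact: measurable_int fi.
- case: ae => N [mN N0 sN]; exists N; split => // x /= hx; apply: sN => /= xE.
  by apply: hx => Sx; rewrite xE// /g patchE mem_set.
Qed.

End density_measure.

Section transported_density.
Context {R : realType} {Y T : ptopologicalType}.
Variables (mu : {finite_measure set (borel Y) -> \bar R}) (B : set Y)
  (u : Y -> R) (F : Y -> T) (K : set T).
Hypotheses (cB : compact B) (clB : closed B) (clK : closed K) (Bn : B !=set0).
Hypotheses (cu : {within B, continuous u}) (u_ge0 : forall y, B y -> 0 <= u y).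
Hypotheses (cF : {within B, continuous F}) (FK : forall y, B y -> K (F y)).

Let mB : measurable (B : set (borel Y)). Proof. exact: closed_borel. Qed.
Let mK : measurable (K : set (borel T)). Proof. exact: closed_borel. Qed.

Lemma within_continuous_measurable_borel (k0 : T) :
  measurable_fun setT ((fun y => if y \in B then F y else k0) : borel Y -> borel T).
Proof.
pose G (y : borel Y) : borel T := if y \in B then F y else k0.
have sub : preimage_set_system setT G (@open T) `<=` measurable; last first.
  exact: (@measurability _ _ (borel Y) (borel T) setT G (@open T) erefl sub).
move=> _ [U oU <-].
have /open_subspaceP[V oV VB] : @open (subspace B) (F @^-1` U).
  by move/continuousP : cF; exact.
rewrite setTI (_ : _ @^-1` _ = (B `&` V) `|` (~` B `&` G @^-1` U)).
  apply: measurableU.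
    by apply: measurableI => //; exact: open_borel.
  have [Uk0|nUk0] := pselect (U k0).
    rewrite (_ : _ `&` _ = ~` B); first exact: (measurableC mB).
    apply/seteqP; split => [y []//|y nBy]; split => //=.
    by rewrite /G memNset.
  rewrite (_ : _ `&` _ = set0)//.
  by apply/seteqP; split => // y [nBy /=]; rewrite /G memNset.
rewrite -[in LHS](setTI (G @^-1` U)) -(setUv B) setIUl; congr (_ `|` _).
rewrite [RHS]setIC VB; apply/seteqP; split => y /=.
  by move=> [By]; rewrite /G mem_set.
by move=> [FU By]; rewrite /G mem_set.
Qed.

(** F matters on B only, since the density vanishes off B; it may be replaced by
    a constant point of K there, which makes it a Borel map into K. *)
Lemma transported_density : exists m : {finite_measure set (borel T) -> \bar R},
  [/\ (m : set (borel T) -> \bar R) =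
        pushforward (density mu B u) (F : borel Y -> borel T),
      m (~` K) = 0%E, m setT = (\int[mu]_(y in B) u y)%:E
    & forall f : T -> R, {within K, continuous f} ->
        (\int[m]_(x in (K : set (borel T))) (f x)%:E)%E =
        (\int[mu]_(y in B) (f (F y) * u y))%:E].
Proof.
have [y0 By0] := Bn.
pose k0 := F y0; have Kk0 : K k0 by exact: FK.
pose G (y : borel Y) : borel T := if y \in B then F y else k0.
have mG : measurable_fun setT G by exact: within_continuous_measurable_borel.
have GE y : B y -> G y = F y by move=> By; rewrite /G mem_set.
have KG y : K (G y) by rewrite /G; case: ifPn => // /set_mem; exact: FK.
have [M M0 uM] := within_continuous_bounded cB cu.
have mu_ := within_continuous_measurable cu.
have ui : mu.-integrable (B : set (borel Y)) (EFin \o u).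
  exact: (@bounded_integrable _ _ _ mu _ mB _ M mu_ uM).
have [lam lamE lamI] := density_finite_measure mB u_ge0 ui.
have [m mE] := pushforward_finite_measure lam mG.
exists m; split.
- rewrite mE; apply/funext => A; rewrite /pushforward lamE /density.
  congr integral; apply/seteqP; split => y /= [+ By]; rewrite GE//.
- rewrite mE /pushforward (_ : _ @^-1` _ = set0) ?measure0//.
  by apply/seteqP; split => // y /=; apply; exact: KG.
- rewrite mE /pushforward preimage_setT lamE /density setTI.
  by rewrite /Rintegral fineK//; exact: integrable_fin_num ui.
move=> f cf; rewrite mE.
have cfF := within_continuous_compose cF FK cf.
have [N N0 fN] := within_continuous_bounded cB cfF.
have mfF := within_continuous_measurable cfF.
have lami : lam.-integrable (B : set (borel Y)) (EFin \o (f \o F)).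
  exact: (@bounded_integrable _ _ _ lam _ mB _ N mfF fN).
have mf : measurable_fun setT (EFin \o (f \_ K) : borel T -> \bar R).
  apply/measurable_EFinP; apply/(measurable_restrictT _ mK).
  exact: within_continuous_measurable.
rewrite integral_mkcond.
rewrite (_ : _ \_ _ = (EFin \o (f \_ K))); last first.
  exact: (restrict_EFin (f : borel T -> R) K).
have fGE y : (EFin \o (f \_ K)) (G y) = (f (G y))%:E.
  by rewrite /= patchE mem_set//; exact: KG.
have lamBC : lam (~` B) = 0%E.
  by rewrite lamE /density setICl integral_set0.
have mBC : measurable (~` B : set (borel Y)) by exact: measurableC mB.
have fGB : measurable_fun (B : set (borel Y)) (fun y : borel Y => f (G y)).
  by apply: eq_measurable_fun mfF => y /set_mem By; rewrite /= GE.
have iG : lam.-integrable setT ((EFin \o (f \_ K)) \o G).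
  have mfG : measurable_fun setT ((f \_ K) \o G).
    by apply/measurable_EFinP; exact: measurableT_comp mf mG.
  apply: (@bounded_integrable _ _ _ lam _ measurableT _ (Num.max N `|f k0|) mfG).
  move=> y _; rewrite (_ : ((f \_ K) \o G) y = f (G y)); last by have [] := fGE y.
  rewrite le_max.
  have [By|nBy] := pselect (B y); first by rewrite GE// fN.
  by rewrite /G memNset// lexx orbT.
rewrite (integral_pushforward mG mf)// preimage_setT.
rewrite (negligible_integral mBC measurableT iG lamBC) setTD setCK.
have -> : (\int[lam]_(x in (B : set (borel Y))) (((EFin \o (f \_ K)) \o G) x) =
    \int[lam]_(x in (B : set (borel Y))) ((f \o F) x)%:E)%E.
  by apply: eq_integral => y /set_mem By; rewrite /= [LHS]fGE GE.
rewrite lamI// /Rintegral fineK//.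
have mfu := measurable_funM mfF mu_.
apply: (@integrable_fin_num _ _ _ mu B mB).
apply: (@bounded_integrable _ _ _ mu _ mB _ (N * M) mfu) => y By.
by rewrite normrM ler_pM// ?fN ?uM.
Qed.

End transported_density.

(** * Harmonic functions and kernels *)

Section boundary.
Context {R : realType} {X : pmetricType R}.

Lemma closed_bdry (A : set X) : closed (bdry A).
Proof.
rewrite /bdry setDE; apply: closedI; first exact: closed_closure.
by apply: open_closedC; exact: open_interior.
Qed.

Lemma bdry_sub_closure (A : set X) : bdry A `<=` closure A.
Proof. by move=> x []. Qed.

Lemma compact_bdry (A : set X) : compact (closure A) -> compact (bdry A).
Proof. by move=> cA; exact: subclosed_compact (@closed_bdry A) cA (@bdry_sub_closure A). Qed.

Lemma measurable_bdry (A : set X) : measurable (bdry A : set (borel X)).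
Proof. by apply: closed_borel; exact: closed_bdry. Qed.

Lemma open_bdry_disj (A : set X) x : open A -> A x -> ~ bdry A x.
Proof. by move=> oA Ax [_]; apply; rewrite /interior; exact: open_nbhs_nbhs. Qed.

End boundary.
Arguments measurable_bdry {R X} A.

Section harmonic.
Context {R : realType} {X : pmetricType R}.
Variables (DD : set (set X)) (omega : set X -> X -> probability (borel X) R).
Hypothesis framework : harmonic_framework DD omega.

Local Notation regular := (regular_domain DD omega).
Local Notation harmonic := (harmonic_in DD omega).

Lemma framework_domain U : DD U -> domain U.
Proof. by have [h _ _] := framework; move=> /h[]. Qed.

Lemma framework_open U : DD U -> open U.
Proof. by move=> /framework_domain[]. Qed.

Lemma framework_bdry U : DD U -> bdry U !=set0.
Proof. by have [h _ _] := framework; move=> /h[_ []]. Qed.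

Lemma omega_bdry U x : DD U -> U x -> omega U x (bdry U) = 1%E.
Proof. by have [h _ _] := framework; move=> /h[_ []] _ + _ _ _; apply. Qed.

Lemma omega_dominates U x y : DD U -> U x -> U y -> omega U x `<< omega U y.
Proof. by have [h _ _] := framework; move=> /h[_ []] _ _ + _ _; apply. Qed.

Lemma regular_nbhs U x : DD U -> U x ->
  exists V, [/\ regular V, rel_compact V U & V x].
Proof.
have [_ h _] := framework; move=> /h[V [rV _ UE]]; rewrite {1}UE => -[n _ Vx].
by exists (V n); have [] := rV n.
Qed.

Lemma integrable_omega V (f : X -> R) x : compact (closure V) -> 
  {within bdry V, continuous f} ->
  (omega V x).-integrable (bdry V : set (borel X)) (EFin \o f).
Proof.
move=> cV cf.
have [B _ fB] := within_continuous_bounded (compact_bdry cV) cf.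
exact: (@bounded_integrable _ _ _ (omega V x) _ (measurable_bdry V) _ B
  (within_continuous_measurable cf) fB).
Qed.

Lemma Rintegral_omega_cst V (c : R) x : DD V -> V x ->
  \int[omega V x]_(_ in bdry V) c = c.
Proof.
move=> dV Vx; rewrite (Rintegral_cst (omega V x) (measurable_bdry V)).
by rewrite [X in fine X](omega_bdry dV Vx) mulr1.
Qed.

Lemma harmonic_cst W (c : R) : harmonic W (fun=> c).
Proof.
split; first by move=> x; exact: cvg_cst.
by move=> V [dV _] _ x Vx; rewrite Rintegral_omega_cst.
Qed.

(** The mean value property passes to the limit because omega has mass 1. *)
Lemma harmonic_uniform_limit W (u : X -> R) :
  (forall eps, 0 < eps -> exists2 v, harmonic W v &
    forall x, W x -> `|u x - v x| <= eps) -> harmonic W u.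
Proof.
move=> lim.
have cu : {within W, continuous u}.
  apply/within_continuousP => x Wx e e0.
  have e3 : 0 < e / 3 by rewrite divr_gt0.
  have [v [/within_continuousP cv _] uv] := lim _ e3.
  have := cv x Wx _ e3; apply: filterS => y h Wy.
  have -> : u x - u y = (u x - v x) + (v x - v y) - (u y - v y) by ring.
  rewrite (_ : e = e / 3 + e / 3 + e / 3); last by field.
  rewrite (le_lt_trans (ler_normB _ _))// ltr_leD//; last exact: uv.
  by rewrite (le_lt_trans (ler_normD _ _))// ler_ltD//; [exact: uv|exact: h].
split => // V rV VW x Vx; have [dV _] := rV; have [cV clVW] := VW.
have bVW : bdry V `<=` W by apply: subset_trans clVW; exact: bdry_sub_closure.
have Wx : W x by apply: clVW; exact: subset_closure.
apply/eqP; rewrite -subr_eq0 -normr_le0; apply/ler_addgt0Pr => e e0.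
rewrite add0r; have e2 : 0 < e / 2 by rewrite divr_gt0.
have [v [cv hv] uv] := lim _ e2.
rewrite (le_trans (ler_distD (v x) _ _))// [leRHS]splitr lerD ?uv//.
rewrite (hv V rV VW x Vx) distrC.
have -> : e / 2 = e / 2 * fine (omega V x (bdry V)).
  by rewrite [X in fine X](omega_bdry dV Vx) mulr1.
apply: (Rintegral_close (measurable_bdry V)).
- by apply: integrable_omega => //; exact: continuous_subspaceW cu.
- by apply: integrable_omega => //; exact: continuous_subspaceW cv.
- by move=> y /bVW; exact: uv.
Qed.

(** A nonnegative harmonic function vanishing at an interior point vanishes
    almost everywhere on the boundary of every regular neighbourhood, for all
    harmonic measures there at once; so its zero set is open. *)
Lemma harmonic_zero U (v : X -> R) a : DD U -> harmonic U v ->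
  (forall x, U x -> 0 <= v x) -> U a -> v a = 0 -> forall x, U x -> v x = 0.
Proof.
move=> dU [cv hv] v0 Ua va.
have oU := framework_open dU.
have cU : connected U by case: (framework_domain dU).
suff ZU : U `&` [set x | v x = 0] = U by move=> x; rewrite -{1}ZU => -[].
have openZ x : U x -> v x = 0 -> \forall y \near x, v y = 0.
  move=> Ux vx; have [V [rV VU Vx]] := regular_nbhs dU Ux.
  have [[dV _] [cV clVU]] := (rV, VU).
  have bVU : bdry V `<=` U by apply: subset_trans clVU; exact: bdry_sub_closure.
  have cvb : {within bdry V, continuous v} by exact: continuous_subspaceW cv.
  have mvb := within_continuous_measurable cvb.
  have mV := measurable_bdry V.
  have vi y := integrable_omega y cV cvb.
  have int0 : (\int[omega V x]_(y in bdry V) `|(v y)%:E| = 0)%E.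
    have := hv V rV VU x Vx; rewrite vx /Rintegral => /esym/eqP.
    rewrite fine_eq0; last exact: integrable_fin_num (vi x).
    move=> /eqP <-; apply: eq_integral => y /set_mem/bVU Uy.
    by rewrite /= ger0_norm// v0.
  have /measurable_EFinP mE := mvb.
  have /(ae_eq_integral_abs (omega V x) mV mE) ae0 := int0.
  have : nbhs x V by apply: open_nbhs_nbhs; split=> //; exact: framework_open.
  apply: filterS => y Vy; rewrite (hv V rV VU y Vy) /Rintegral.
  have ae0y : ae_eq (omega V y) (bdry V) (EFin \o v) (cst 0%E).
    case: ae0 => N [mN N0 sN]; exists N; split => //.
    have nN : null_set (omega V x) N.
      by move=> A mA AN; exact: (subset_measure0 mA mN AN N0).
    by have := omega_dominates dV Vy Vx nN; apply.
  rewrite (@ae_eq_integral _ _ _ (omega V y) _ (cst 0%E) _ mV mE _ ae0y).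
    by rewrite integral0.
  exact: measurable_cst.
apply: cU.
- by exists a.
- exists [set x | \forall y \near x, v y = 0].
    rewrite openE => x /= vx; rewrite /interior; near=> y.
    by near: y; exact: near_join.
  apply/seteqP; split => x [Ux] /=; first by move=> vx; split => //; exact: openZ.
  by move=> vx; split => //; exact: nbhs_singleton vx.
- exists (closure (U `&` [set x | v x = 0])); first exact: closed_closure.
  apply/seteqP; split => x [Ux] /=.
    by move=> vx; split => //; exact: subset_closure.
  move=> clx; split => //; apply/eqP; rewrite -normr_le0; apply/ler_addgt0Pr => e e0.
  move/within_continuousP : cv => /(_ x Ux _ e0) /clx[y [[Uy vy] /(_ Uy)]].
  by rewrite vy subr0 add0r => /ltW.
Unshelve. all: by end_near. Qed.

End harmonic.

Section kernel.
Context {R : realType} {X : pmetricType R}.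
Variables (DD : set (set X)) (omega : set X -> X -> probability (borel X) R).
Hypothesis framework : harmonic_framework DD omega.

Local Notation regular := (regular_domain DD omega).
Local Notation harmonic := (harmonic_in DD omega).

Variables (U : set X) (x0 : X) (k : X -> X -> R).
Hypotheses (rU : regular U) (cU : compact (closure U)) (Ux0 : U x0).
Hypothesis kk : continuous_kernel omega x0 U k.

Let dU : DD U. Proof. by case: rU. Qed.
Let mbU : measurable (bdry U : set (borel X)). Proof. exact: measurable_bdry. Qed.
Let cbU : compact (bdry U). Proof. exact: compact_bdry. Qed.
Let oU : open U. Proof. exact: (framework_open framework dU). Qed.

(** Regularity forces harmonic measure to charge every relatively open subset
    of the boundary: near a boundary point of the set nearly all the mass sits
    in it, and null sets do not depend on the pole. *)
Lemma omega_full_support (O : set X) zeta : open O -> bdry U zeta -> O zeta ->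
  (0 < omega U x0 (bdry U `&` O))%E.
Proof.
move=> oO bz Oz; rewrite lt0e measure_ge0 andbT; apply/negP => /eqP o0.
have mO : measurable (O : set (borel X)) by exact: open_borel.
have mA : measurable (bdry U `&` O : set (borel X)) by exact: measurableI.
have ox x : U x -> omega U x (bdry U `&` O) = 0%E.
  move=> Ux; have dom := omega_dominates framework dU Ux Ux0.
  have /dom : null_set (omega U x0) (bdry U `&` O).
    by move=> A mA' AO; exact: (subset_measure0 mA' mA AO o0).
  by apply.
pose f : X -> R := \1_O.
have bf : bounded_borel U f.
  split; first by apply: measurable_funTS; exact: measurable_indic.
  exists 1; split; first exact: num_real.
  move=> y y1 z _ /=; rewrite (le_trans _ (ltW y1))// /f indicE.
  by case: (_ \in _); rewrite ?normr1 ?normr0.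
have fz : f @ within (bdry U) (nbhs zeta) --> f zeta.
  apply: cvg_near_cst; rewrite near_withinE; near=> y => _.
  rewrite /f !indicE !mem_set//.
  by near: y; exact: open_nbhs_nbhs.
have := rU.2 zeta f bz bf fz.
have ffil : ProperFilter (within U (nbhs zeta)).
  apply: within_nbhs_proper; exact: bdry_sub_closure.
have I0 x : U x -> \int[omega U x]_(y in bdry U) f y = 0.
  move=> Ux; rewrite /Rintegral integral_indic//.
  by rewrite [X in fine X](_ : _ = 0%E)// setIC; exact: ox.
have to0 : (\int[omega U x]_(y in bdry U) f y) @[x --> within U (nbhs zeta)] --> (0 : R).
  apply: cvg_near_cst; rewrite near_withinE; near=> y => Uy.
  exact: I0.
move=> /(cvg_lim (@Rhausdorff R)); rewrite (cvg_lim (@Rhausdorff R) to0).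
by rewrite /f indicE mem_set// => /eqP; rewrite eq_sym oner_eq0.
Unshelve. all: by end_near. Qed.

Let bint x (A : set (borel X)) (f : X -> R) : measurable A -> A `<=` bdry U ->
  {within bdry U, continuous f} -> (omega U x).-integrable A (EFin \o f).
Proof.
move=> mA AU cf; apply: (integrableS mbU mA AU).
exact: integrable_omega.
Qed.

(** A point where f is negative would give a relatively open set, of positive
    mass by full support, over which the integral of f is negative. *)
Lemma bdry_ge0 (f : X -> R) : {within bdry U, continuous f} ->
  (forall A : set (borel X), measurable A -> A `<=` bdry U ->
     0 <= \int[omega U x0]_(y in A) f y) ->
  forall y, bdry U y -> 0 <= f y.
Proof.
move=> cf f0 y by_; rewrite leNgt; apply/negP => fy0.
have fy2 : 0 < - f y / 2 by rewrite divr_gt0// oppr_gt0.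
have := (within_continuousP _ _).1 cf y by_ _ fy2.
rewrite /prop_near1 nbhsE => -[G [oG Gy] HG].
pose A : set (borel X) := bdry U `&` G.
have mA : measurable A by apply: measurableI => //; exact: open_borel.
have AU : A `<=` bdry U by move=> z [].
have := f0 A mA AU; apply/negP; rewrite -ltNge.
have cint : (omega U x0).-integrable A (EFin \o fun=> f y / 2).
  by apply: bint => //; move=> z; exact: cvg_cst.
apply: (@le_lt_trans _ _ (\int[omega U x0]_(z in A) (f y / 2))).
  apply: le_Rintegral => //; first exact: bint.
  move=> z [bz Gz]; have /= := HG z Gz bz; rewrite ltr_norml => /andP[h _].
  by lra.
rewrite Rintegral_cst// pmulr_llt0; first lra.
by apply: fine_gt0; rewrite (omega_full_support oG by_ Gy)/= ltey_eq fin_num_measure.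
Qed.

Lemma bdry_eq (f g : X -> R) : {within bdry U, continuous f} ->
  {within bdry U, continuous g} ->
  (forall A : set (borel X), measurable A -> A `<=` bdry U ->
     \int[omega U x0]_(y in A) f y = \int[omega U x0]_(y in A) g y) ->
  forall y, bdry U y -> f y = g y.
Proof.
move=> cf cg fg y by_; apply/eqP; rewrite eq_le -!(subr_ge0 _ (_ y)).
apply/andP; split; apply: (@bdry_ge0 (fun y => _ y - _ y) _ _ y by_).
- by move=> z; apply: cvgB; [exact: cg|exact: cf].
- by move=> A mA AU; rewrite RintegralB ?fg ?subrr//; exact: bint.
- by move=> z; apply: cvgB; [exact: cf|exact: cg].
- by move=> A mA AU; rewrite RintegralB ?fg ?subrr//; exact: bint.
Qed.

Lemma kernel_continuous_bdry x : U x -> {within bdry U, continuous (k x)}.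
Proof. by move=> Ux; exact: within_continuous_section Ux kk.2. Qed.

(** In differential form, d omega_x = k(x, .) d omega_x0. *)
Lemma kernel_change_of_pole x (A : set (borel X)) (f : X -> R) : U x ->
  measurable A -> A `<=` bdry U -> {within bdry U, continuous f} ->
  \int[omega U x]_(y in A) f y = \int[omega U x0]_(y in A) (f y * k x y).
Proof.
move=> Ux mA AU cf.
have dom := omega_dominates framework dU Ux Ux0.
rewrite /Rintegral; congr fine.
rewrite -(Radon_Nikodym_change_of_variables dom mA (bint x mA AU cf)).
have mf : measurable_fun A f.
  apply: measurable_funS mbU AU _; exact: within_continuous_measurable.
have mk : measurable_fun A (k x).
  apply: measurable_funS mbU AU _; apply: within_continuous_measurable.
  exact: kernel_continuous_bdry.
apply: ae_eq_integral => //.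
- apply: emeasurable_funM; first exact/measurable_EFinP.
  by apply: measurable_funTS; apply: measurable_int;
    apply: Radon_Nikodym_integrable.
- by apply/measurable_EFinP; exact: measurable_funM.
- have [N [mN N0 sN]] := kk.1 x Ux; exists N; split => // y /= h; apply: sN => /= hy.
  apply: h => Ay; rewrite EFinM; congr (_ * _)%E.
  by rewrite hy//; exact: AU.
Qed.

Let cst1 : {within bdry U, continuous (fun=> 1 : R)}.
Proof. by move=> z; exact: cvg_cst. Qed.

Lemma kernel_mass x (A : set (borel X)) : U x -> measurable A -> A `<=` bdry U ->
  \int[omega U x0]_(y in A) k x y = fine (omega U x A).
Proof.
move=> Ux mA AU; rewrite -[RHS]mul1r -Rintegral_cst//.
rewrite (kernel_change_of_pole Ux mA AU cst1).
by apply: eq_Rintegral => y _; rewrite mul1r.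
Qed.

Lemma kernel_pole y : bdry U y -> k x0 y = 1.
Proof.
apply: (bdry_eq (kernel_continuous_bdry Ux0) cst1) => A mA AU.
by rewrite kernel_mass// Rintegral_cst// mul1r.
Qed.

Lemma kernel_ge0 x y : U x -> bdry U y -> 0 <= k x y.
Proof.
move=> Ux; apply: (bdry_ge0 (kernel_continuous_bdry Ux)) => A mA AU.
by rewrite kernel_mass// fine_ge0.
Qed.

(** The kernel inherits harmonicity from the measures: both sides of the mean
    value property have the same integral over every Borel set of boundary
    points, by the composition property of the harmonic measures and
    exchange of integrals. *)
Lemma kernel_harmonic y : bdry U y -> harmonic U (k^~ y).
Proof.
move=> bUy; split.
  exact: (within_continuous_section (f := fun y x => k x y) bUy
    (within_continuous_flip kk.2)).
move=> V rV VU x Vx; have [[dV _] [cV clVU]] := (rV, VU).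
have bVU : bdry V `<=` U by apply: subset_trans clVU; exact: bdry_sub_closure.
have Ux : U x by apply: clVU; exact: subset_closure.
have mbV := measurable_bdry V.
have cbV := compact_bdry cV.
have ckV : {within bdry V `*` bdry U, continuous (fun p : X * X => k p.1 p.2)}.
  by apply: continuous_subspaceW kk.2 => -[a b] [/= /bVU].
have [M M0 kM] := within_continuous_bounded (compact_setX cbV cbU) ckV.
have kz z : bdry V z -> {within bdry U, continuous (k z)}.
  by move=> /bVU; exact: kernel_continuous_bdry.
have kint w z : bdry U z -> (omega V w).-integrable (bdry V : set (borel X)) (EFin \o k^~ z).
  move=> bz; apply: integrable_omega => //.
  exact: (within_continuous_section (f := fun y x => k x y) bz
    (within_continuous_flip ckV)).
apply: (@bdry_eq (k x) (fun y => \int[omega V x]_(z in bdry V) k z y)) => //.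
- exact: kernel_continuous_bdry.
- apply/within_continuousP => z bz e e0.
  have e2 : 0 < e / 2 by rewrite divr_gt0.
  have := tube_near cbV ckV bz e2; apply: filterS => z' h bz'.
  apply: (@le_lt_trans _ _ (e / 2)); last by rewrite ltr_pdivrMr// ltr_pMr// ltr1n.
  have -> : e / 2 = e / 2 * fine (omega V x (bdry V)).
    by rewrite [X in fine X](omega_bdry framework dV Vx) mulr1.
  apply: (Rintegral_close mbV); [exact: kint|exact: kint|].
  by move=> w bw; apply/ltW/h.
move=> A mA AU.
rewrite kernel_mass//.
have bA : bounded_borel U (\1_A : X -> R).
  split; first by apply: measurable_funTS; exact: measurable_indic.
  exists 1; split; first exact: num_real.
  move=> w y1 z _ /=; rewrite (le_trans _ (ltW y1))// indicE.
  by case: (_ \in _); rewrite ?normr1 ?normr0.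
have intA w : \int[omega U w]_(z in bdry U) (\1_A z : R) = fine (omega U w A).
  by rewrite /Rintegral integral_indic// setIidl.
have [_ _ comp] := framework.
have := comp U V dU rV VU _ x bA Vx; rewrite intA => ->.
transitivity (\int[omega V x]_(w in bdry V) \int[omega U x0]_(z in A) k w z).
  by apply: eq_Rintegral => w /set_mem/bVU Uw; rewrite intA kernel_mass.
apply: (@Rintegral_swap_equicontinuous _ _ _ _ (omega V x) (omega U x0) _ _ _ M) => //.
- move=> w bw; apply: measurable_funS mbU AU _.
  by apply: within_continuous_measurable; exact: kz.
- by move=> w z bw Az; apply: (kM (w, z)); split => //=; exact: AU.
- move=> e e0 w bw.
  have := tube_near (f := fun z w => k w z) cbU (within_continuous_flip ckV) bw e0.
  by apply: filterS => w' h bw' z Az; apply/ltW/h => //; exact: AU.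
Qed.

(** The kernel is 1 at the pole, so by [harmonic_zero] it has no zero. *)
Lemma kernel_gt0 x y : U x -> bdry U y -> 0 < k x y.
Proof.
move=> Ux bUy; rewrite lt_neqAle kernel_ge0// andbT; apply/negP => /eqP/esym kxy.
have := harmonic_zero framework dU (kernel_harmonic bUy)
  (fun x Ux => kernel_ge0 Ux bUy) Ux kxy Ux0.
by rewrite kernel_pole// => /eqP; rewrite oner_eq0.
Qed.

(** The mean value property with the pole moved to x0. *)
Lemma harmonic_kernel W (h : X -> R) x : harmonic W h -> rel_compact U W ->
  U x -> h x = \int[omega U x0]_(y in bdry U) (h y * k x y).
Proof.
move=> [ch hh] UW Ux; rewrite (hh U rU UW x Ux).
apply: kernel_change_of_pole => //.
apply: continuous_subspaceW ch; apply: subset_trans UW.2.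
exact: bdry_sub_closure.
Qed.

End kernel.

(** * Bounds along the exhaustion *)

Section harmonic_restriction.
Context {R : realType} {X : pmetricType R}.
Variables (DD : set (set X)) (omega : set X -> X -> probability (borel X) R).
Local Notation harmonic := (harmonic_in DD omega).

Lemma harmonic_eq W (u v : X -> R) : (forall x, W x -> u x = v x) ->
  harmonic W u -> harmonic W v.
Proof.
move=> uv [/within_continuousP cu hu]; split.
  apply/within_continuousP => x Wx e e0; have := cu x Wx e e0.
  by apply: filterS => y h Wy; rewrite -!uv//; exact: h.
move=> V rV VW x Vx; rewrite -uv; last by apply: VW.2; exact: subset_closure.
rewrite (hu V rV VW x Vx); apply: eq_Rintegral => y /set_mem[cy _].
by rewrite uv//; exact: VW.2.
Qed.

Lemma harmonic_subset W W' (u : X -> R) : W' `<=` W ->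
  harmonic W u -> harmonic W' u.
Proof.
move=> WW [cu hu]; split; first exact: continuous_subspaceW cu.
move=> V rV [cV VW'] x Vx; apply: hu => //; split => //.
exact: subset_trans VW' WW.
Qed.

End harmonic_restriction.

Section exhaustion.
Context {R : realType} {X : pmetricType R}.
Variables (DD : set (set X)) (omega : set X -> X -> probability (borel X) R).
Variables (D : set X) (x0 : X) (D_ : nat -> set X) (K : nat -> X -> X -> R).
Hypothesis framework : harmonic_framework DD omega.
Hypothesis regularD_ : forall n, regular_domain DD omega (D_ n).
Hypothesis D0x0 : D_ 0%N x0.
Hypothesis D_S : forall n, rel_compact (D_ n) (D_ n.+1).
Hypothesis DE : D = \bigcup_n D_ n.
Hypothesis kernelK : forall n, continuous_kernel omega x0 (D_ n) (K n).

Local Notation harmonic := (harmonic_in DD omega).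
Local Notation L := (L_ D_).
Local Notation a := (a_ D_ K).
Local Notation b := (b_ D_ K).
Local Notation Omega := (Omega_ D_ K).

Lemma exhaustion_le m n : (m <= n)%N -> D_ m `<=` D_ n.
Proof.
elim: n => [|n IH]; first by rewrite leqn0 => /eqP ->.
rewrite leq_eqVlt => /predU1P[->//|/IH mn]; apply: (subset_trans mn).
by move=> x Dx; apply: (D_S n).2; exact: subset_closure.
Qed.

Lemma L_sub_exhaustion m n : (m < n)%N -> L m `<=` D_ n.
Proof. by move=> mn; apply: subset_trans (D_S m).2 _; exact: exhaustion_le. Qed.

Lemma exhaustion_sub_L m : D_ m `<=` L m.
Proof. exact: subset_closure. Qed.

Lemma L_le m n : (m <= n)%N -> L m `<=` L n.
Proof. by move=> mn; apply: closure_subset; exact: exhaustion_le. Qed.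

Lemma exhaustion_sub n : D_ n `<=` D.
Proof. by rewrite DE => x Dx; exists n. Qed.

Lemma L_sub m : L m `<=` D.
Proof. by apply: subset_trans (@exhaustion_sub m.+1); exact: L_sub_exhaustion. Qed.

Lemma exhaustion_open n : open (D_ n).
Proof. exact: (framework_open framework (regularD_ n).1). Qed.

Lemma exhaustion_pole n : D_ n x0.
Proof. exact: exhaustion_le D0x0. Qed.

Lemma L_pole m : L m x0.
Proof. by apply: exhaustion_sub_L; exact: exhaustion_pole. Qed.

Lemma L_compact m : compact (L m).
Proof. by case: (D_S m). Qed.

Lemma bdry_exhaustion_sub n : bdry (D_ n) `<=` D.
Proof. by apply: subset_trans (@L_sub n); exact: bdry_sub_closure. Qed.

Lemma rel_compact_exhaustion m n W : (m < n)%N -> D_ n `<=` W ->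
  rel_compact (D_ m) W.
Proof.
move=> mn nW; split; first exact: L_compact.
by apply: subset_trans nW; exact: L_sub_exhaustion.
Qed.

Lemma compact_in_exhaustion (C : set X) : compact C -> C `<=` D ->
  exists n, C `<=` D_ n.
Proof.
move=> /compact_near_coveringP cC CD.
have [N _ HN] : \forall n \near \oo, C `<=` D_ n.
  apply: cC => x Cx; have := CD x Cx; rewrite DE => -[n _ Dnx].
  exists (D_ n, [set m | (n <= m)%N]) => /=; last first.
    by move=> [y m] [/= Dy nm]; exact: exhaustion_le Dy.
  split; last by exists n.
  by apply: open_nbhs_nbhs; split => //; exact: exhaustion_open.
by exists N; apply: (HN N) => /=.
Qed.

Lemma harmonic_exhaustion (u : X -> R) : (forall n, harmonic (D_ n) u) ->
  harmonic D u.
Proof.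
move=> hu; split.
  apply/within_continuousP => x; rewrite {1}DE => -[n _ Dnx] e e0.
  have := (within_continuousP _ _).1 (hu n).1 x Dnx e e0.
  apply: filterS2 (open_nbhs_nbhs (conj (@exhaustion_open n) Dnx)) => y Dny h _.
  exact: h.
move=> V rV [cV VD] x Vx; have [n Vn] := compact_in_exhaustion cV VD.
exact: (hu n).2.
Qed.

Lemma K_continuous m :
  {within L m `*` bdry (D_ m.+1), continuous (fun p : X * X => K m.+1 p.1 p.2)}.
Proof.
apply: continuous_subspaceW (kernelK m.+1).2 => -[s z] [/= Ls bz].
by split => //=; apply: L_sub_exhaustion Ls.
Qed.

Let cLb m : compact (L m `*` bdry (D_ m.+1)).
Proof. by apply: compact_setX; [exact: L_compact|apply/compact_bdry/L_compact]. Qed.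

Let Kgt0 m s z : L m s -> bdry (D_ m.+1) z -> 0 < K m.+1 s z.
Proof.
move=> Ls bz; apply: (kernel_gt0 framework (regularD_ m.+1) _
  (exhaustion_pole m.+1) (kernelK m.+1)) => //; first exact: L_compact.
exact: L_sub_exhaustion Ls.
Qed.

Let bn m : bdry (D_ m) !=set0.
Proof. exact: (framework_bdry framework (regularD_ m).1). Qed.

Lemma K_between m s z : L m s -> bdry (D_ m.+1) z -> a m <= K m.+1 s z <= b m.
Proof.
move=> Ls bz; have [M _ KM] := within_continuous_bounded (@cLb m) (@K_continuous m).
apply/andP; split.
  apply: ge_inf; last by exists s => //; exists z.
  exists (- M) => _ [s' Ls' [z' bz' <-]].
  by have := KM (s', z') (conj Ls' bz'); rewrite ler_norml => /andP[].
apply: ub_le_sup; last by exists s => //; exists z.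
exists M => _ [s' Ls' [z' bz' <-]].
by have := KM (s', z') (conj Ls' bz'); rewrite ler_norml => /andP[].
Qed.

(** The reciprocal of the positive continuous kernel is bounded on a compact
    set. *)
Lemma a_gt0 m : 0 < a m.
Proof.
have cV : {within L m `*` bdry (D_ m.+1),
    continuous (fun p : X * X => (K m.+1 p.1 p.2)^-1)}.
  apply/subspace_continuousP => p [Ls bz].
  apply: cvgV; first by rewrite gt_eqF// Kgt0.
  by have /subspace_continuousP := @K_continuous m; apply.
have [M M0 KM] := within_continuous_bounded (@cLb m) cV.
have [z bz] := bn m.+1.
apply: (@lt_le_trans _ _ M^-1); first by rewrite invr_gt0.
apply: lb_le_inf; first by exists (K m.+1 x0 z), x0; [exact: L_pole|exists z].
move=> _ [s Ls [z' bz' <-]]; have K0 := Kgt0 Ls bz'.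
have := KM (s, z') (conj Ls bz'); rewrite /= ger0_norm; last by rewrite invr_ge0; exact: ltW.
by move=> KM'; rewrite -[leRHS]invrK lef_pV2 ?posrE ?invr_gt0.
Qed.

Lemma Omega_ubound m s t z : L m s -> L m t -> bdry (D_ m.+1) z ->
  `|K m.+1 s z - K m.+1 t z| <= Omega m s t.
Proof.
move=> Ls Lt bz; have [M _ KM] := within_continuous_bounded (@cLb m) (@K_continuous m).
apply: ub_le_sup; last by exists z.
exists (M + M) => _ [z' bz' <-].
rewrite (le_trans (ler_normB _ _))// lerD//.
  exact: (KM (s, z') (conj Ls bz')).
exact: (KM (t, z') (conj Lt bz')).
Qed.

Lemma Omega_ge0 m s t : L m s -> L m t -> 0 <= Omega m s t.
Proof.
move=> Ls Lt; have [z bz] := bn m.+1.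
by apply: le_trans (Omega_ubound Ls Lt bz).
Qed.

(** The kernel is continuous in the first variable uniformly over the compact
    boundary. This modulus makes the sets Q m equicontinuous. *)
Lemma Omega_small m s (eps : R) : L m s -> 0 < eps ->
  \forall t \near s, L m t -> Omega m s t <= eps.
Proof.
move=> Ls e0; have cb : compact (bdry (D_ m.+1)) by apply/compact_bdry/L_compact.
have := tube_near (f := fun z s => K m.+1 s z) cb
  (within_continuous_flip (@K_continuous m)) Ls e0.
apply: filterS => t h Lt; apply: ge_sup.
  by have [z bz] := bn m.+1; exists `|K m.+1 s z - K m.+1 t z|, z.
by move=> _ [z bz <-]; apply/ltW/h.
Qed.

(** Harnack inequality and equicontinuity for normalized harmonic functions,
    read off the kernel representation on D_{m+1}. *)
Lemma harmonic_Harnack m W (h : X -> R) s t : harmonic W h ->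
  rel_compact (D_ m.+1) W -> (forall z, bdry (D_ m.+1) z -> 0 <= h z) ->
  h x0 = 1 -> L m s -> L m t ->
  a m <= h s <= b m /\ `|h s - h t| <= Omega m s t.
Proof.
move=> hh DW h0 hx0 Ls Lt.
pose B := bdry (D_ m.+1); pose mu := omega (D_ m.+1) x0.
have mB : measurable (B : set (borel X)) by exact: measurable_bdry.
have cB : compact B by apply/compact_bdry/L_compact.
have ch : {within B, continuous h}.
  apply: continuous_subspaceW hh.1; apply: subset_trans DW.2.
  exact: bdry_sub_closure.
have ck r : L m r -> {within B, continuous (K m.+1 r)}.
  by move=> Lr; exact: within_continuous_section Lr (@K_continuous m).
have hi : mu.-integrable (B : set (borel X)) (EFin \o h).
  by apply: integrable_omega => //; exact: L_compact.
have ki r : L m r -> mu.-integrable (B : set (borel X)) (EFin \o (h \* K m.+1 r)).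
  move=> Lr; apply: integrable_omega; first exact: L_compact.
  by move=> z; apply: cvgM; [exact: ch|exact: ck].
have ci (c : R) : mu.-integrable (B : set (borel X)) (EFin \o (fun z => h z * c)).
  apply: integrable_omega; first exact: L_compact.
  by move=> z; apply: cvgM; [exact: ch|exact: cvg_cst].
have hE r : L m r -> h r = \int[mu]_(z in B) (h z * K m.+1 r z).
  move=> Lr; apply: (harmonic_kernel framework (regularD_ m.+1) _
    (exhaustion_pole m.+1) (kernelK m.+1) hh DW); first exact: L_compact.
  exact: L_sub_exhaustion Lr.
have h1 : \int[mu]_(z in B) h z = 1.
  rewrite -hx0 (hh.2 (D_ m.+1))//; exact: exhaustion_pole.
have hc c : \int[mu]_(z in B) (h z * c) = c by rewrite RintegralZr// h1 mul1r.
split.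
  rewrite hE//; apply/andP; split; [rewrite -[leLHS]hc|rewrite -[leRHS]hc];
    apply: le_Rintegral => //; try exact: ki; move=> z bz;
    by have /andP[? ?] := K_between Ls bz; rewrite ler_wpM2l// h0.
rewrite (hE s Ls) (hE t Lt) -RintegralB//; try exact: ki.
have sti : mu.-integrable (B : set (borel X))
    (EFin \o (fun z => h z * K m.+1 s z - h z * K m.+1 t z)).
  by apply: integrable_omega; [exact: L_compact|move=> z; apply: cvgB;
    apply: cvgM; (try exact: ch); exact: ck].
rewrite (le_trans (le_normr_Rintegral mB sti))// -(hc (Omega m s t)).
apply: le_Rintegral => //; first exact: integrable_norm sti.
move=> z bz; rewrite -mulrBr normrM ger0_norm ?h0// ler_wpM2l ?h0//.
exact: Omega_ubound.
Qed.

End exhaustion.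

(** * The compact product *)

Section extension_by_zero.
Context {R : realType} {X : Type}.

Lemma ext_sigL (A : set X) (f : X -> R) x : A x -> ext (sigL A f) x = f x.
Proof.
move=> Ax; have := congr1 (fun g => g f x) (@sigLK X R 0 A).
by rewrite /ext/= => ->; rewrite /patch mem_set.
Qed.

Lemma ext_val (A : set X) (g : A -> R) (s : A) : ext g (val s) = g s.
Proof. exact: (congr1 (fun h => h s) (@valLK X R 0 A g)). Qed.

Lemma ext_valE (A : set X) (g : A -> R) x (Ax : A x) :
  ext g x = g (SigSub (mem_set Ax)).
Proof. by rewrite -ext_val. Qed.

Lemma ext_out (A : set X) (g : A -> R) x : ~ A x -> ext g x = 0.
Proof.
move=> nAx.
have -> : g = sigL A (ext g) by apply/funext => s; rewrite -[LHS]ext_val.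
have := congr1 (fun h => h (ext g) x) (@sigLK X R 0 A).
by rewrite /ext/= => ->; rewrite /patch memNset.
Qed.

Lemma ext_inj (A : set X) (g h : A -> R) :
  (forall x, A x -> ext g x = ext h x) -> g = h.
Proof.
move=> gh; apply/funext => s; rewrite -[LHS]ext_val -[RHS]ext_val.
by apply: gh; exact: set_valP.
Qed.

End extension_by_zero.

Section uniform_product.
Context {R : realType} {X : pmetricType R}.
Variable L : nat -> set X.
Local Notation U := (@unif_prod R X L).

Lemma near_ext m (p : U) (eps : R) : 0 < eps ->
  \forall q \near p, forall s, `|ext (p m) s - ext (q m) s| < eps.
Proof.
move=> e0.
have nb : nbhs (p m) (ball (p m) eps) by exact: nbhsx_ballx.
have np : nbhs p [set q : U | ball (p m) eps (q m)] :=
  @proj_continuous nat (fun m => arrow_uniform_type (L m) R) m p _ nb.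
apply: filterS np => q pq s.
have [Ls|nLs] := pselect (L m s); last by rewrite !ext_out// subrr normr0.
by rewrite !(ext_valE _ Ls); exact: (pq (SigSub (mem_set Ls))).
Qed.

Lemma continuous_ext m s : continuous (fun p : U => ext (p m) s).
Proof.
move=> p; have pF : Filter (nbhs p) by exact: nbhs_filter.
apply/cvgrPdist_lt => e e0; have := near_ext m p e0.
by apply: filterS => q; exact.
Qed.

Lemma unif_prod_eq (p q : U) :
  (forall m s, L m s -> ext (p m) s = ext (q m) s) -> p = q.
Proof.
move=> pq; apply: functional_extensionality_dep => m.
by apply: (@ext_inj _ _ (L m)) => x; exact: pq.
Qed.

Lemma unif_prod_hausdorff : hausdorff_space U.
Proof.
move=> p q clpq; apply: unif_prod_eq => m s Ls.
apply/eqP; rewrite -subr_eq0 -normr_le0; apply/ler_addgt0Pr => e e0.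
have e2 : 0 < e / 2 by rewrite divr_gt0.
have [r [pr qr]] := clpq _ _ (near_ext m p e2) (near_ext m q e2).
rewrite add0r (le_trans (ler_distD (ext (r m) s) _ _))// (splitr e) lerD//.
  exact: ltW.
by rewrite distrC ltW.
Qed.

Lemma unif_prod_cvg {T : Type} (F : set_system T) (f : T -> U) (p : U) :
  Filter F -> (forall m (eps : R), 0 < eps ->
    \forall t \near F, forall s, L m s -> `|ext (p m) s - ext (f t m) s| < eps) ->
  f @ F --> p.
Proof.
move=> FF fp.
suff : forall m, (fun t => f t m) @ F --> (p m : arrow_uniform_type (L m) R).
  move=> h; apply/cvg_sup => m V [W [[G oG <-] Gp] WV].
  apply: (filterS WV); apply: (h m); exact: open_nbhs_nbhs.
move=> m; apply/cvg_ballP => eps e0.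
have := fp m eps e0; apply: filterS => t h s.
by have := h (val s) (set_valP s); rewrite !ext_val.
Qed.

End uniform_product.

Section compact_product.
Context {R : realType} {X : pmetricType R}.
Variables (DD : set (set X)) (omega : set X -> X -> probability (borel X) R).
Variables (D : set X) (x0 : X) (D_ : nat -> set X) (K : nat -> X -> X -> R).
Hypothesis framework : harmonic_framework DD omega.
Hypothesis regularD_ : forall n, regular_domain DD omega (D_ n).
Hypothesis D0x0 : D_ 0%N x0.
Hypothesis D_S : forall n, rel_compact (D_ n) (D_ n.+1).
Hypothesis DE : D = \bigcup_n D_ n.
Hypothesis kernelK : forall n, continuous_kernel omega x0 (D_ n) (K n).

Local Notation harmonic := (harmonic_in DD omega).
Local Notation L := (L_ D_).
Local Notation a := (a_ D_ K).
Local Notation b := (b_ D_ K).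
Local Notation Omega := (Omega_ D_ K).
Local Notation Q := (Q_ DD omega x0 D_ K).
Local Notation P := (P_ DD omega x0 D_ K).
Local Notation H := (HP DD omega x0 D D_).
Local Notation H1 := (H1 DD omega x0 D).
Local Notation U := (@unif_prod R X L).

Let pole := exhaustion_pole D0x0 D_S.
Let Lpole := L_pole D0x0 D_S.

Lemma Q_uniform_limit m (g : L m -> R) :
  (forall eps : R, 0 < eps -> exists2 f, Q m f &
    forall s, L m s -> `|ext g s - ext f s| <= eps) -> Q m g.
Proof.
move=> lim; split.
- apply/(@subspace_valL_continuousP' X (L m) R 0 g); apply/within_continuousP.
  move=> s Ls e e0; have e3 : 0 < e / 3 by rewrite divr_gt0.
  have [f [cf _ _ _] gf] := lim _ e3.
  have /within_continuousP/(_ s Ls _ e3) := (@subspace_valL_continuousP' X (L m) R 0 f).2 cf.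
  apply: filterS => t ft Lt.
  have {}ft : `|ext f s - ext f t| < e / 3 := ft Lt.
  suff : `|ext g s - ext g t| < e by [].
  by move: (gf s Ls) (gf t Lt) ft; rewrite !ler_norml !ltr_norml; lra.
- apply: (harmonic_uniform_limit framework) => eps /lim[f [_ hf _ _] gf].
  exists (ext f) => // s Ds; apply: gf; exact: subset_closure.
- apply/eqP; rewrite -subr_eq0 -normr_le0; apply/ler_addgt0Pr => e e0.
  have [f [_ _ <- _] gf] := lim _ e0; rewrite add0r; apply: gf; exact: Lpole.
- move=> i im s t Ls Lt.
  have Lms : L m s by exact: (L_le D_S im).
  have Lmt : L m t by exact: (L_le D_S im).
  split; first apply/andP; first split; apply/ler_addgt0Pr => e e0.
  + have [f [_ _ _ Qf] gf] := lim _ e0.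
    have [/andP[+ _] _] := Qf i im s t Ls Lt.
    have := gf s Lms; rewrite ler_norml; lra.
  + have [f [_ _ _ Qf] gf] := lim _ e0.
    have [/andP[_ +] _] := Qf i im s t Ls Lt.
    have := gf s Lms; rewrite ler_norml; lra.
  + have e2 : 0 < e / 2 by rewrite divr_gt0.
    have [f [_ _ _ Qf] gf] := lim _ e2.
    have [_ ft] := Qf i im s t Ls Lt.
    by move: (gf s Lms) (gf t Lmt) ft; rewrite !ler_norml; lra.
Qed.

Let Q_bound m f i s : Q m f -> (i <= m)%N -> L i s -> a i <= ext f s <= b i.
Proof. by move=> [_ _ _ Qf] im Ls; have [] := Qf i im s s Ls Ls. Qed.

(** Ascoli: along an ultrafilter on Q m the values at every point converge, by
    boundedness, and they converge uniformly, by equicontinuity on the compact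
    set L m. *)
Lemma Q_compact m : compact (Q m).
Proof.
rewrite compact_ultra => F FU FQ.
have FF : ProperFilter F by exact: ultra_proper.
pose ev s (f : arrow_uniform_type (L m) R) : R := ext f s.
have evF s : exists r : R, L m s -> ev s @ F --> r.
  have [Ls|nLs] := pselect (L m s); last by exists 0.
  have [|r [_ clr]] := @segment_compact R (a m) (b m) (ev s @ F) _.
    have sub : Q m `<=` ev s @^-1` `[a m, b m]%classic.
      by move=> f Qf; rewrite /= in_itv/=; exact: (Q_bound Qf (leqnn m) Ls).
    exact: filterS sub FQ.
  exists r => _; apply/cvgrPdist_lt => e e0.
  pose G := [set f | `|r - ev s f| < e].
  have [//|nF] := in_ultra_setVsetC G FU.
  have nF' : (ev s @ F) (ev s @` (~` G)).
    suff sub : ~` G `<=` ev s @^-1` (ev s @` (~` G)) by exact: filterS sub nF.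
    by move=> f nf; exists f.
  by have [_ [[f nf <-] fe]] := clr _ (ball r e) nF' (nbhsx_ballx _ _ e0).
have [g gF] := choice evF.
have gFs s e : L m s -> 0 < e -> \forall f \near F, `|g s - ev s f| < e.
  by move=> Ls e0; have /cvgrPdist_lt/(_ _ e0) := gF s Ls.
have gOmega s t : L m s -> L m t -> `|g s - g t| <= Omega m s t.
  move=> Ls Lt; apply/ler_addgt0Pr => e e0.
  have e2 : 0 < e / 2 by rewrite divr_gt0.
  have [f [[Qf fs] ft]] :=
    filter_ex (filterI (filterI FQ (gFs s _ Ls e2)) (gFs t _ Lt e2)).
  have [_ _ _ /(_ m (leqnn m) s t Ls Lt)[_ fst]] := Qf.
  by move: fs ft fst; rewrite /ev /= !ltr_norml !ler_norml; lra.
have unif e : 0 < e -> \forall f \near F, forall s, L m s -> `|g s - ev s f| <= e.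
  move=> e0; have e3 : 0 < e / 3 by rewrite divr_gt0.
  have [|S SL Scov] := @compact_nbhs_cover X (L m)
    (fun s => [set t | L m t -> Omega m s t <= e / 3]) (@L_compact _ _ _ D_S m).
    by move=> s Ls; exact: (Omega_small framework regularD_ D_S kernelK).
  have nS : \forall f \near F, forall s, s \in S -> `|g s - ev s f| < e / 3.
    elim: S SL {Scov} => [_|s S IH SL]; first by near=> f.
    have h1 := gFs s _ (SL s (mem_head _ _)) e3.
    have h2 := IH (fun t tS => SL t (mem_behead (s := s :: S) tS)).
    by apply: filterS2 h1 h2 => f fs fS t; rewrite inE => /predU1P[->|/fS].
  apply: filterS2 FQ nS => f Qf fS t Lt; have [s sS st] := Scov t Lt.
  have Ls := SL s sS.
  have [_ _ _ /(_ m (leqnn m) s t Ls Lt)[_ fst]] := Qf.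
  move: (fS s sS) fst (gOmega s t Ls Lt) (st Lt).
  by rewrite /ev !ltr_norml !ler_norml; lra.
pose g' : arrow_uniform_type (L m) R := sigL (L m) g.
exists g'; split.
  apply: Q_uniform_limit => e e0.
  have [f [Qf uf]] := filter_ex (filterI FQ (unif e e0)).
  by exists f => // s Ls; rewrite ext_sigL//; exact: uf.
apply/cvg_ballP => e e0.
have e2 : 0 < e / 2 by rewrite divr_gt0.
have := unif _ e2; apply: filterS => f fe s.
have := fe (val s) (set_valP s); rewrite /ev ext_val => h.
apply: (@le_lt_trans _ _ (e / 2)); first by exact: h.
by rewrite ltr_pdivrMr// ltr_pMr// ltr1n.
Unshelve. all: by end_near. Qed.

Lemma P_compact : compact P.
Proof.
exact: (@tychonoff nat (fun m => arrow_uniform_type (L m) R) (fun m => Q m) Q_compact).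
Qed.

Lemma P_closed : closed P.
Proof. by apply: compact_closed P_compact; exact: unif_prod_hausdorff. Qed.

End compact_product.

Section embedding.
Context {R : realType} {X : pmetricType R}.
Variables (DD : set (set X)) (omega : set X -> X -> probability (borel X) R).
Variables (D : set X) (x0 : X) (D_ : nat -> set X) (K : nat -> X -> X -> R).
Hypothesis framework : harmonic_framework DD omega.
Hypothesis regularD_ : forall n, regular_domain DD omega (D_ n).
Hypothesis D0x0 : D_ 0%N x0.
Hypothesis D_S : forall n, rel_compact (D_ n) (D_ n.+1).
Hypothesis DE : D = \bigcup_n D_ n.
Hypothesis kernelK : forall n, continuous_kernel omega x0 (D_ n) (K n).

Local Notation harmonic := (harmonic_in DD omega).
Local Notation L := (L_ D_).
Local Notation a := (a_ D_ K).
Local Notation b := (b_ D_ K).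
Local Notation Omega := (Omega_ D_ K).
Local Notation Q := (Q_ DD omega x0 D_ K).
Local Notation P := (P_ DD omega x0 D_ K).
Local Notation H := (HP DD omega x0 D D_).
Local Notation H1 := (H1 DD omega x0 D).
Local Notation U := (@unif_prod R X L).
Local Notation T_ := (T_ D_ K).
Local Notation restrictions := (restrictions D D_).

Let pole := exhaustion_pole D0x0 D_S.
Let Lpole := L_pole D0x0 D_S.

Lemma Q_of_harmonic m W (h : X -> R) : harmonic W h ->
  rel_compact (D_ m.+1) W -> (forall x, W x -> 0 <= h x) -> h x0 = 1 ->
  Q m (sigL (L m) h).
Proof.
move=> hh DW h0 hx0.
have LW : L m `<=` W.
  by apply: subset_trans DW.2; apply: (L_le D_S); exact: leqnSn.
split.
- apply/subspace_sigL_continuousP; exact: continuous_subspaceW hh.1.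
- apply: (@harmonic_eq _ _ _ _ (D_ m) h).
    by move=> x Dx; rewrite ext_sigL//; exact: subset_closure.
  by apply: harmonic_subset hh; apply: subset_trans LW; exact: subset_closure.
- by rewrite ext_sigL//; exact: Lpole.
- move=> i im s t Ls Lt; rewrite !ext_sigL; try exact: (L_le D_S im).
  have DiW : rel_compact (D_ i.+1) W.
    split; first exact: (L_compact D_S).
    by apply: subset_trans DW.2; exact: (L_le D_S).
  apply: (harmonic_Harnack framework regularD_ D0x0 D_S kernelK hh DiW) => //.
  by move=> z bz; apply/h0/DiW.2; exact: bdry_sub_closure.
Qed.

Lemma kernel_in_P n y : bdry (D_ n) y -> P (T_ n y).
Proof.
move=> bny m; rewrite /Defs.T_; case: ifPn => [mn|_].
  have cDn : compact (closure (D_ n)) by exact: (L_compact D_S).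
  apply: (@Q_of_harmonic m (D_ n)).
  - exact: (kernel_harmonic framework (regularD_ n) cDn (pole n) (kernelK n) bny).
  - exact: (rel_compact_exhaustion D_S mn (@subset_refl _ (D_ n))).
  - move=> x Dx.
    exact: (kernel_ge0 framework (regularD_ n) cDn (pole n) (kernelK n) Dx bny).
  - exact: (kernel_pole framework (regularD_ n) cDn (pole n) (kernelK n) bny).
have -> : (fun=> 1) = sigL (L m) (fun=> 1) :> (L m -> R) by [].
by apply: (@Q_of_harmonic m (D_ m.+2)) => //; exact: (harmonic_cst framework).
Qed.

Lemma T_continuous n : {within bdry (D_ n), continuous (T_ n)}.
Proof.
apply/subspace_continuousP => y bny.
apply: (@unif_prod_cvg _ _ L X (within (bdry (D_ n)) (nbhs y)) (T_ n) (T_ n y) _).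
move=> m e e0.
rewrite /Defs.T_; case: ifPn => [mn|_]; last first.
  by apply: nearW => t s Ls; rewrite !(ext_valE _ Ls) subrr normr0.
have ck : {within L m `*` bdry (D_ n), continuous (fun p : X * X => K n p.1 p.2)}.
  apply: continuous_subspaceW (kernelK n).2 => -[s z] [/= Ls bz].
  by split => //=; apply: (L_sub_exhaustion D_S _ Ls); exact: ltn_trans mn.
have := tube_near (@L_compact _ _ _ D_S m) ck bny e0.
rewrite near_withinE; apply: filterS => z h bz s Ls.
by rewrite !ext_sigL//; exact: h.
Qed.

Lemma T_ext n y m x : (m.+2 <= n)%N -> L m x -> ext (T_ n y m) x = K n x y.
Proof. by move=> mn Lx; rewrite /Defs.T_ mn ext_sigL. Qed.

Lemma restrictions_ext (h : @locunif R X D) m x : L m x ->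
  ext (restrictions h m) x = ext (A := D) h x.
Proof. by move=> Lx; rewrite /Defs.restrictions ext_sigL. Qed.

Let LD m : L m `<=` D. Proof. exact: (L_sub D_S DE). Qed.

Lemma H1_gt0 (h : @locunif R X D) x : H1 h -> D x -> 0 < ext (A := D) h x.
Proof. by move=> [h0 _ _] Dx; rewrite (ext_valE _ Dx). Qed.

Lemma restrictions_in_P (h : @locunif R X D) : H1 h -> P (restrictions h).
Proof.
move=> hH m; have [_ hh hx0] := hH.
apply: (@Q_of_harmonic m D) => //.
- by apply: (rel_compact_exhaustion D_S (ltnSn _)); exact: (exhaustion_sub DE).
- by move=> x Dx; rewrite ltW//; exact: H1_gt0.
Qed.

(** A compatible sequence defines a function on D which is harmonic on every
    D_ n; it is positive because its m-th term is bounded below by a m > 0.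
    Conversely members of H1 satisfy the bounds defining P by
    [harmonic_Harnack]. *)
Lemma HP_compatible : H = P `&` [set p | forall m s, L m s ->
  ext (p m.+1) s = ext (p m) s].
Proof.
apply/seteqP; split => [_ [h hH <-]|p [Pp comp]].
  split; first exact: restrictions_in_P.
  by move=> m s Ls; rewrite !restrictions_ext//; apply: (L_le D_S (leqnSn m)).
have comp_le m n s : (m <= n)%N -> L m s -> ext (p n) s = ext (p m) s.
  elim: n => [|n IH]; first by rewrite leqn0 => /eqP ->.
  rewrite leq_eqVlt ltnS => /predU1P[->//|mn] Ls.
  by rewrite comp ?IH//; exact: (L_le D_S mn).
have lev x : exists n, D x -> L n x.
  have [Dx|nDx] := pselect (D x); last by exists 0%N.
  by move: Dx; rewrite DE => -[n _ Dnx]; exists n => _; exact: subset_closure.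
have [lv lvP] := choice lev.
pose hh x := ext (p (lv x)) x.
have hhE m x : L m x -> hh x = ext (p m) x.
  move=> Lx; have Dx := LD Lx; have Llv := lvP x Dx.
  have [le|/ltnW le] := leqP m (lv x); first exact: comp_le.
  by rewrite /hh; apply/esym/comp_le.
pose h : @locunif R X D := sigL D hh.
have hE m x : L m x -> ext (A := D) h x = ext (p m) x.
  by move=> Lx; rewrite ext_sigL ?(hhE m)//; exact: LD Lx.
exists h; last first.
  apply: unif_prod_eq => m s Ls.
  by rewrite restrictions_ext// (hE m).
split.
- move=> x; have Dx : D (val x) by exact: set_valP.
  rewrite -[h x](@ext_val R X D h).
  have Lx := lvP _ Dx; rewrite (hE _ _ Lx).
  have [_ _ _ Qp] := Pp (lv (val x)).
  have [/andP[ah _] _] := Qp _ (leqnn _) _ _ Lx Lx.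
  exact: lt_le_trans (a_gt0 framework regularD_ D0x0 D_S kernelK _) ah.
- apply: (harmonic_exhaustion framework regularD_ D_S DE) => n.
  have [_ hp _ _] := Pp n.
  apply: harmonic_eq hp => x Dnx; rewrite (hE n)//; exact: subset_closure.
- by rewrite (hE 0%N) ?Lpole//; have [_ _ -> _] := Pp 0%N.
Qed.

Lemma HP_sub_P : H `<=` P.
Proof. by rewrite HP_compatible => p []. Qed.

Lemma HP_closed : closed H.
Proof.
rewrite HP_compatible; apply: closedI; first exact: P_closed.
have -> : [set p : U | forall m s, L m s -> ext (p m.+1) s = ext (p m) s] =
    \bigcap_(ms in [set ms : nat * X | L ms.1 ms.2])
      ((fun p : U => ext (p ms.1.+1) ms.2 - ext (p ms.1) ms.2) @^-1` [set 0]).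
  apply/seteqP; split => p /=.
    by move=> h [m s] /= Ls; apply/eqP; rewrite subr_eq0 h.
  by move=> h m s Ls; apply/eqP; rewrite -subr_eq0; apply/eqP; exact: (h (m, s)).
apply: closed_bigI => -[m s] _ /=.
have c1 := @continuous_ext _ _ L m.+1 s.
have c2 := @continuous_ext _ _ L m s.
apply: (@preimage_closed U R (fun p : U => ext (p m.+1) s - ext (p m) s)); last first.
  exact: closed_eq.
move=> p _. exact: (cvgB (c1 p) (c2 p)).
Qed.

(** Any member of H1 whose restrictions form g takes these values, whichever
    one the choice operator picks. *)
Lemma evalH_ext (g : U) m x : H g -> L m x ->
  evalH DD omega x0 D D_ g x = ext (g m) x.
Proof.
move=> [h hH hg] Lx; rewrite /evalH.
have : (H1 `&` [set h | restrictions h = g])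
    (xget (fun=> 0) (H1 `&` [set h | restrictions h = g])).
  by apply: xgetPex; exists h.
by move: (xget _ _) => h' [_ /= <-]; rewrite restrictions_ext.
Qed.

End embedding.

(** * Limits of boundary measures *)

Section boundary_limits.
Context {R : realType} {X : pmetricType R}.
Variables (DD : set (set X)) (omega : set X -> X -> probability (borel X) R).
Variables (D : set X) (x0 : X) (D_ : nat -> set X) (K : nat -> X -> X -> R).
Variable u : X -> R.
Hypothesis framework : harmonic_framework DD omega.
Hypothesis regularD_ : forall n, regular_domain DD omega (D_ n).
Hypothesis D0x0 : D_ 0%N x0.
Hypothesis D_S : forall n, rel_compact (D_ n) (D_ n.+1).
Hypothesis DE : D = \bigcup_n D_ n.
Hypothesis kernelK : forall n, continuous_kernel omega x0 (D_ n) (K n).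
Hypothesis harmonic_u : harmonic_in DD omega D u.
Hypothesis u_ge0 : forall x, D x -> 0 <= u x.

Local Notation L := (L_ D_).
Local Notation P := (P_ DD omega x0 D_ K).
Local Notation H := (HP DD omega x0 D D_).
Local Notation U := (@unif_prod R X L).
Local Notation T_ := (T_ D_ K).

(* The two cases of interest are T = U with prj the identity, for the measures
   rho, and T = Dhat x U with prj the second projection, for Lambda. *)
Variables (T : ptopologicalType) (prj : T -> U) (F : nat -> X -> T) (C : set T).
Arguments prj : clear implicits.
Hypotheses (cprj : continuous prj) (clC : closed C).
Hypothesis CP : forall p, C p -> P (prj p).
Hypothesis cF : forall n, {within bdry (D_ n), continuous (F n)}.
Hypothesis FC : forall n y, bdry (D_ n) y -> C (F n y).
Hypothesis prjF : forall n y, bdry (D_ n) y -> prj (F n y) = T_ n y.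

Let Dn_D n : rel_compact (D_ n) D.
Proof. exact: (rel_compact_exhaustion D_S (ltnSn n) (exhaustion_sub DE (n := n.+1))). Qed.

Let cbn n : compact (bdry (D_ n)).
Proof. by apply: compact_bdry; exact: (L_compact D_S). Qed.

Let cu n : {within bdry (D_ n), continuous u}.
Proof. apply: continuous_subspaceW harmonic_u.1; exact: (bdry_exhaustion_sub D_S DE). Qed.

(** The total mass is u x0 by the mean value property at x0. *)
Lemma boundary_image n : exists m : {finite_measure set (borel T) -> \bar R},
  [/\ (m : set (borel T) -> \bar R) =
        pushforward (lambda_ omega x0 D_ u n) (F n : borel X -> borel T),
      m (~` C) = 0%E, m setT = (u x0)%:E
    & forall f : T -> R, {within C, continuous f} ->
        (\int[m]_(x in (C : set (borel T))) (f x)%:E)%E =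
        (\int[omega (D_ n) x0]_(y in bdry (D_ n)) (f (F n y) * u y))%:E].
Proof.
have bn : bdry (D_ n) !=set0 by exact: (framework_bdry framework (regularD_ n).1).
have u0 y : bdry (D_ n) y -> 0 <= u y.
  by move=> /(bdry_exhaustion_sub D_S DE); exact: u_ge0.
have [m [mE mC mT mI]] := transported_density (omega (D_ n) x0) (@cbn n)
  (@closed_bdry _ _ (D_ n)) clC bn (@cu n) u0 (@cF n) (@FC n).
exists m; split => //.
rewrite mT [in RHS](harmonic_u.2 _ (regularD_ n) (Dn_D n))//.
exact: (exhaustion_pole D0x0 D_S).
Qed.

Variables (phi : nat -> nat) (sigma : {finite_measure set (borel T) -> \bar R}).
Hypothesis phi_lt : {homo phi : m n / (m < n)%N}.
Hypothesis sigma_lim : weak_cvg C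
  ((fun n => pushforward (lambda_ omega x0 D_ u n) (F n : borel X -> borel T))
     \o phi) sigma.

Let mC : measurable (C : set (borel T)). Proof. exact: closed_borel. Qed.

Let phi_ge n : (n <= phi n)%N.
Proof. by elim: n => // n IH; exact: leq_ltn_trans (phi_lt (ltnSn n)). Qed.

Lemma limit_integral (f : T -> R) (N : nat) (r : R) : {within C, continuous f} ->
  (forall n, (N <= n)%N ->
    \int[omega (D_ n) x0]_(y in bdry (D_ n)) (f (F n y) * u y) = r) ->
  (\int[sigma]_(p in (C : set (borel T))) (f p)%:E = r%:E)%E.
Proof.
move=> cf fr; have lim := sigma_lim cf.
apply/esym/(cvg_unique (@ereal_hausdorff R) _ lim).
apply: cvg_near_cst; exists N => // n Nn /=.
have [m [<- _ _ ->]] := boundary_image (phi n); last exact: cf.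
by rewrite fr// (leq_trans Nn).
Qed.

Lemma limit_mass : sigma C = (u x0)%:E.
Proof.
have c1 : {within C, continuous (fun=> 1 : R)} by move=> z; exact: cvg_cst.
rewrite -(limit_integral (N := 0) c1 (r := u x0)).
  by rewrite integral_cst// mul1e.
move=> n _; rewrite (harmonic_u.2 _ (regularD_ n) (Dn_D n)).
  by apply: eq_Rintegral => y _; rewrite mul1r.
exact: (exhaustion_pole D0x0 D_S).
Qed.

Let cext (m : nat) (x : X) : continuous (fun p : T => ext (prj p m) x : R).
Proof.
move=> p; apply: (@continuous_comp T U R prj (fun q : U => ext (q m) x)).
  exact: cprj.
exact: (@continuous_ext _ _ L m x).
Qed.

(** By the kernel representation on D_ n, the integral against the n-th measure
    is u x as soon as n >= m + 2. *)
Lemma limit_representation m x : L m x ->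
  (u x)%:E = (\int[sigma]_(p in (C : set (borel T))) (ext (prj p m) x)%:E)%E.
Proof.
move=> Lx; apply/esym/(@limit_integral _ m.+2).
  by apply: continuous_subspaceT; exact: cext.
move=> n mn; have Dnx : D_ n x by apply: (L_sub_exhaustion D_S _ Lx); exact: ltnW.
have cDn : compact (closure (D_ n)) by exact: (L_compact D_S).
rewrite (harmonic_kernel framework (regularD_ n) cDn
  (exhaustion_pole D0x0 D_S n) (kernelK n) harmonic_u (Dn_D n) Dnx).
by apply: eq_Rintegral => y /set_mem bny; rewrite prjF// T_ext// mulrC.
Qed.

(** The integral of f against the limit is 0, and f is nonnegative on C. *)
Lemma limit_null (f : T -> R) (N : nat) : continuous f ->
  (forall p, C p -> 0 <= f p) ->
  (forall n y, (N <= n)%N -> bdry (D_ n) y -> f (F n y) = 0) ->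
  sigma (C `&` [set p | f p <> 0]) = 0%E.
Proof.
move=> cf f0 fF.
have cfC : {within C, continuous f} by exact: continuous_subspaceT.
have int0 : (\int[sigma]_(p in (C : set (borel T))) `|(f p)%:E| = 0)%E.
  rewrite (@eq_integral _ (borel T) _ _ _ (fun p => (f p)%:E)); last first.
    by move=> p /set_mem Cp; rewrite /= ger0_norm// f0.
  apply: (limit_integral (N := N) cfC) => n Nn.
  rewrite (@eq_Rintegral _ _ _ _ _ (fun=> 0)); last first.
    by move=> y /set_mem bny; rewrite fF// mul0r.
  by rewrite (Rintegral_cst (omega (D_ n) x0) (measurable_bdry (D_ n))) mul0r.
have mf := within_continuous_measurable cfC.
have /measurable_EFinP mE := mf.
have /(ae_eq_integral_abs sigma mC mE) [Z [mZ Z0 sZ]] := int0.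
apply: (subset_measure0 _ mZ _ Z0).
  rewrite (_ : [set p | f p <> 0] = ~` (f @^-1` [set 0])); last by [].
  apply: measurableI => //; apply: open_borel; apply: closed_openC.
  by apply: preimage_closed; [move=> p _; exact: cf|exact: closed_eq].
by move=> p [Cp fp]; apply: sZ => /= h; apply: fp; case: (h Cp).
Qed.

(** T_ n y is compatible up to level n - 2, so the gaps between consecutive
    levels, at the points of countable dense sets, integrate to 0 in the
    limit; by continuity these gaps detect every incompatibility. *)
Lemma limit_compatible : sigma (C `&` [set p | ~ H (prj p)]) = 0%E.
Proof.
have dn m : exists d : nat -> X, (forall i, L m (d i)) /\
    forall x (e : R), L m x -> 0 < e -> exists i, ball (d i) e x.
  have [d dL dd] := compact_dense_seq (@L_compact _ _ _ D_S m) (L_pole D0x0 D_S m).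
  by exists d.
have [d /all_and2[dL dd]] := choice dn.
pose f (mi : nat * nat) (p : T) :=
  `|ext (prj p mi.1.+1) (d mi.1 mi.2) - ext (prj p mi.1) (d mi.1 mi.2)|.
pose Z (k : nat) : set (borel T) :=
  if @unpickle (nat * nat)%type k is Some mi then C `&` [set p | f mi p <> 0] else set0.
have cf mi : continuous (f mi).
  move=> p; apply: cvg_norm; apply: cvgB; exact: cext.
have mf mi : measurable (C `&` [set p | f mi p <> 0] : set (borel T)).
  rewrite (_ : [set p | f mi p <> 0] = ~` (f mi @^-1` [set 0])); last by [].
  apply: measurableI => //; apply: open_borel; apply: closed_openC.
  by apply: preimage_closed; [move=> p _; exact: cf|exact: closed_eq].
have Z0 k : sigma (Z k) = 0%E.
  rewrite /Z; case: unpickle => [[m i]|]; last by rewrite measure0.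
  apply: (@limit_null (f (m, i)) m.+3) => [|p _|n y mn bny];
    [exact: cf|exact: normr_ge0|].
  rewrite /f/= prjF// !T_ext ?subrr ?normr0//; try exact: dL; try exact: ltnW.
  by apply: (L_le D_S (leqnSn m)); exact: dL.
have mZ k : measurable (Z k).
  by rewrite /Z; case: unpickle => // mi; exact: mf.
have clH : closed H by exact: (HP_closed framework regularD_ D0x0 D_S DE kernelK).
apply: (@subset_measure0 _ _ _ _ _ (\bigcup_k Z k)).
- apply: measurableI => //; apply: open_borel; rewrite -[X in open X]setCK.
  apply: closed_openC.
  rewrite (_ : ~` _ = prj @^-1` H).
    by apply: preimage_closed clH => p _; exact: cprj.
  by apply/seteqP; split => p /=; [exact: contrapT|move=> h; exact].
- exact: bigcupT_measurable.
- move=> p [Cp]; rewrite /= (HP_compatible framework regularD_ D0x0 D_S DE kernelK).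
  move=> nH.
  have [m [s [Ls ms]]] : exists m s, L m s /\ ext (prj p m.+1) s <> ext (prj p m) s.
    apply: contrapT => h; apply: nH; split; first exact: CP.
    move=> m s Ls; apply: contrapT => ms; apply: h; by exists m, s.
  pose g s := ext (prj p m.+1) s - ext (prj p m) s.
  have cg : {within L m, continuous g}.
    have Q1 := CP Cp m.+1; have Q0 := CP Cp m.
    have c1 : {within L m, continuous (ext (prj p m.+1))}.
      have [c _ _ _] := Q1; apply: (@continuous_subspaceW _ _ _ (L m.+1)).
        exact: (L_le D_S (leqnSn m)).
      exact: (@subspace_valL_continuousP' X (L m.+1) R 0 _).2.
    have c0 : {within L m, continuous (ext (prj p m))}.
      have [c _ _ _] := Q0; exact: (@subspace_valL_continuousP' X (L m) R 0 _).2.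
    by move=> z; apply: cvgB; [exact: c1|exact: c0].
  have gs0 : 0 < `|g s|.
    by rewrite normr_gt0 subr_eq0; apply/eqP.
  have := (within_continuousP _ _).1 cg s Ls _ gs0.
  move=> /nbhs_ballP[e /= e0 se].
  have [i /ball_sym di] := dd m s e Ls e0.
  exists (pickle (m, i)) => //; rewrite /Z pickleK; split => //=.
  have := se _ di (dL m i) => h; rewrite /f/= -/(g (d m i)) => /normr0_eq0 g0.
  by rewrite g0 subr0 ltxx in h.
- exact: null_bigcup.
Qed.

End boundary_limits.

(** * Averages of normalized harmonic functions *)

Section mixtures.
Context {R : realType} {X : pmetricType R}.
Variables (DD : set (set X)) (omega : set X -> X -> probability (borel X) R).
Variables (D : set X) (x0 : X) (D_ : nat -> set X) (K : nat -> X -> X -> R).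
Hypothesis framework : harmonic_framework DD omega.
Hypothesis regularD_ : forall n, regular_domain DD omega (D_ n).
Hypothesis D0x0 : D_ 0%N x0.
Hypothesis D_S : forall n, rel_compact (D_ n) (D_ n.+1).
Hypothesis DE : D = \bigcup_n D_ n.
Hypothesis kernelK : forall n, continuous_kernel omega x0 (D_ n) (K n).

Local Notation L := (L_ D_).
Local Notation H1 := (H1 DD omega x0 D).
Local Notation ev h x := (ext (A := D) h x).

Lemma continuous_eval_locunif x : continuous (fun h : @locunif R X D => ev h x).
Proof.
move=> h; have [Dx|nDx] := pselect (D x); last first.
  apply: (@cvg_near_cst (@locunif R X D) R _ _ (nbhs h) (nbhs_filter h)).
  by apply: nearW => h'; rewrite !ext_out.
pose xD : D := SigSub (mem_set Dx).
have evE (h' : @locunif R X D) : ev h' x = h' xD.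
  exact: (ext_valE _ Dx).
suff : (fun h' : @locunif R X D => ev h' x) @ nbhs h --> ev h x by [].
rewrite evE (funext evE).
have hh : nbhs (h : {family compact, D -> R}) --> (h : {family compact, D -> R}).
  exact: cvg_id.
have FF : Filter (nbhs (h : {family compact, D -> R})) by exact: nbhs_filter.
move/fam_cvgP : hh => /(_ _ (@compact_set1 _ xD)).
by rewrite uniform_set1.
Qed.

Variables (tau : {finite_measure set (borel (@locunif R X D)) -> \bar R})
  (A : set (borel (@locunif R X D))).
Hypotheses (mA : measurable A) (AH : A `<=` H1).

Local Notation uA := (fun x => \int[tau]_(h in A) ev h x).

Let mev x : measurable_fun A (fun h : borel (@locunif R X D) => ev h x).
Proof.
apply: within_continuous_measurable; apply: continuous_subspaceT.
exact: continuous_eval_locunif.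
Qed.

Let bounds m s t h : A h -> L m s -> L m t ->
  a_ D_ K m <= ev h s <= b_ D_ K m /\ `|ev h s - ev h t| <= Omega_ D_ K m s t.
Proof.
move=> /AH Hh Ls Lt; have Hh' := Hh; case: Hh' => _ hh hx0.
apply: (harmonic_Harnack framework regularD_ D0x0 D_S kernelK hh) => //.
  exact: (rel_compact_exhaustion D_S (ltnSn m.+1) (exhaustion_sub DE (n := m.+2))).
by move=> z /(bdry_exhaustion_sub D_S DE) Dz; exact: (ltW (H1_gt0 Hh Dz)).
Qed.

Let evB m s h : A h -> L m s -> `|ev h s| <= b_ D_ K m.
Proof.
move=> Ah Ls; have [/andP[ah hb] _] := bounds Ah Ls Ls.
by rewrite ger0_norm// (le_trans _ ah)// ltW//;
  exact: (a_gt0 framework regularD_ D0x0 D_S kernelK).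
Qed.

Let inL x : D x -> exists m, L m x.
Proof. by rewrite DE => -[m _ Dmx]; exists m; exact: subset_closure. Qed.

Lemma mixture_integrable x : D x -> tau.-integrable A (fun h => (ev h x)%:E).
Proof.
move=> /inL[m Lx].
exact: (@bounded_integrable _ _ _ tau _ mA _ _ (mev x) (fun h Ah => evB Ah Lx)).
Qed.

Let uA_Omega m s t : L m s -> L m t ->
  `|uA s - uA t| <= Omega_ D_ K m s t * fine (tau A).
Proof.
move=> Ls Lt; apply: (Rintegral_close mA).
- by apply: mixture_integrable; exact: (L_sub D_S DE Ls).
- by apply: mixture_integrable; exact: (L_sub D_S DE Lt).
- by move=> h Ah; have [_] := bounds Ah Ls Lt.
Qed.

Let open_near m x : D_ m x -> \forall y \near x, L m y.
Proof.
move=> Dx; have := open_nbhs_nbhs (conj (exhaustion_open framework regularD_ m) Dx).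
by apply: filterS => y; exact: subset_closure.
Qed.

Lemma mixture_continuous : {within D, continuous uA}.
Proof.
apply/within_continuousP => x; rewrite {1}DE => -[m _ Dmx] e e0.
have Lx : L m x by exact: subset_closure.
pose d := e / 2 / (fine (tau A) + 1).
have t0 : 0 < fine (tau A) + 1 by rewrite ltr_wpDl// fine_ge0.
have d0 : 0 < d by rewrite !divr_gt0.
have := Omega_small framework regularD_ D_S kernelK Lx d0.
apply: filterS2 (open_near Dmx) => y Ly Oy _.
apply: (le_lt_trans (uA_Omega Lx Ly)).
apply: (@le_lt_trans _ _ (e / 2)); last by rewrite ltr_pdivrMr// ltr_pMr// ltr1n.
apply: (@le_trans _ _ (d * (fine (tau A) + 1))); last by rewrite /d divfK// gt_eqF.
apply: ler_pM => //; [exact: (Omega_ge0 framework regularD_ D_S kernelK)| |exact: Oy|].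
  by rewrite fine_ge0.
by rewrite lerDl.
Qed.

(** The modulus Omega gives the equicontinuity which allows the integrals to be
    exchanged. *)
Lemma mixture_harmonic : harmonic_in DD omega D uA.
Proof.
split; first exact: mixture_continuous.
move=> V rV VD x Vx; have [cV clVD] := VD.
have [n Vn] := compact_in_exhaustion framework regularD_ D_S DE cV clVD.
have bL : bdry V `<=` L n.
  by move=> y /bdry_sub_closure/Vn; exact: subset_closure.
rewrite (Rintegral_swap_equicontinuous (k := fun y h => ev h y) (M := b_ D_ K n)
  (omega V x) tau (compact_bdry cV) (measurable_bdry V) mA).
- apply: eq_Rintegral => h /set_mem Ah.
  by have [_ hh _] := AH Ah; exact: (hh.2 V rV VD x Vx).
- by move=> y _; exact: mev.
- by move=> y h /bL Ly Ah; exact: evB.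
- move=> e e0 y /bL Ly.
  have := Omega_small framework regularD_ D_S kernelK Ly e0.
  apply: filterS => y' Oy /bL Ly' h Ah; apply: le_trans (Oy Ly').
  by have [_] := bounds Ah Ly Ly'.
Qed.

Lemma mixture_pole : (uA x0)%:E = tau A.
Proof.
have -> : uA x0 = \int[tau]_(_ in A) 1.
  by apply: eq_Rintegral => h /set_mem /AH[].
by rewrite (Rintegral_cst tau mA) mul1r fineK// fin_num_measure.
Qed.

(** Members of H1 are at least a m > 0 on L m. *)
Lemma mixture_gt0 x : (0 < tau A)%E -> D x -> 0 < uA x.
Proof.
move=> tA Dx; have [m Lx] := inL Dx.
have a0 := a_gt0 framework regularD_ D0x0 D_S kernelK m.
apply: (@lt_le_trans _ _ (a_ D_ K m * fine (tau A))).
  by rewrite mulr_gt0// fine_gt0// tA ltey_eq fin_num_measure.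
rewrite -(Rintegral_cst tau mA); apply: le_Rintegral => //.
- apply: (@bounded_integrable _ _ _ tau _ mA _ (a_ D_ K m)) => //.
  by move=> h _; rewrite ger0_norm// ltW.
- exact: mixture_integrable.
- by move=> h Ah; have [/andP[]] := bounds Ah Lx Lx.
Qed.

Lemma mixture_eq0 x : ~ (0 < tau A)%E -> D x -> uA x = 0.
Proof.
move=> tA Dx; have t0 : tau A = 0%E.
  by apply/eqP; rewrite eq_le measure_ge0 andbT leNgt; apply/negP.
rewrite /Rintegral null_set_integral//.
by apply/measurable_EFinP; exact: mev.
Qed.

End mixtures.

(** * The boundary of the compactification *)

Section compactification.
Context {R : realType} {X : pmetricType R}.
Variables (DD : set (set X)) (omega : set X -> X -> probability (borel X) R).
Variables (D : set X) (x0 : X) (D_ : nat -> set X) (K : nat -> X -> X -> R).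
Variables (Dhat : pmetricType R) (j : X -> Dhat).
Hypothesis framework : harmonic_framework DD omega.
Hypothesis regularD_ : forall n, regular_domain DD omega (D_ n).
Hypothesis D0x0 : D_ 0%N x0.
Hypothesis D_S : forall n, rel_compact (D_ n) (D_ n.+1).
Hypothesis DE : D = \bigcup_n D_ n.
Hypothesis compD : compactification D j.

(** Since D_ m has compact closure in D, its image is open in the
    compactification: by density an open trace of it cannot leave the compact
    image of the closure. *)
Lemma open_image_exhaustion m : open (j @` (D_ m)).
Proof.
have [[_ haus] injj cj tracej densej] := compD.
have DmD := exhaustion_sub DE (n := m).
have [W oW DW] := tracej _ (exhaustion_open framework regularD_ m).
rewrite setIidr// in DW.
have cL : compact (j @` (L_ D_ m)).
  apply: continuous_compact; last exact: (L_compact D_S).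
  by apply: continuous_subspaceW cj; exact: (L_sub D_S DE).
have clL : closed (j @` (L_ D_ m)) by exact: compact_closed.
have WL : W `<=` j @` (L_ D_ m).
  move=> w Ww; apply: contrapT => nLw.
  have oWL : open (W `&` ~` (j @` (L_ D_ m))).
    by apply: openI => //; exact: closed_openC.
  have [||z [[Wz nLz] jDz]] := densej (W `&` ~` (j @` (L_ D_ m))) => //.
    by exists w.
  have : (j @` D `&` W) z by [].
  rewrite -DW => -[x Dx jx]; apply: nLz; exists x => //.
  exact: subset_closure.
rewrite DW setIidr//; apply: (subset_trans WL) => _ [x Lx <-].
by exists x => //; exact: (L_sub D_S DE Lx).
Qed.

Lemma closed_corona : closed (~` (j @` D)).
Proof.
rewrite DE image_bigcup; apply: open_closedC; apply: bigcup_open => m _.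
exact: open_image_exhaustion.
Qed.

(** D_ m is contained in the open set D_ n, which is disjoint from its
    boundary. *)
Lemma bdry_image_escape m n y : (m <= n)%N -> bdry (D_ n) y -> ~ (j @` (D_ m)) (j y).
Proof.
move=> mn bny [x Dmx jxy].
have [_ injj _ _ _] := compD.
have Dy : D y by exact: (bdry_exhaustion_sub D_S DE bny).
have Dx : D x by exact: (exhaustion_sub DE Dmx).
have xy : x = y by apply: injj => //; apply/mem_set.
apply: (open_bdry_disj (exhaustion_open framework regularD_ n) _ bny).
by rewrite -xy; exact: (exhaustion_le D_S mn).
Qed.

End compactification.

Section main.
Context {R : realType} {X : pmetricType R}.
Variables (DD : set (set X)) (omega : set X -> X -> probability (borel X) R).
Variables (D : set X) (x0 : X) (D_ : nat -> set X) (K : nat -> X -> X -> R).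
Variables (Dhat : pmetricType R) (j : X -> Dhat) (u : X -> R).
Hypothesis framework : harmonic_framework DD omega.
Hypothesis regularD_ : forall n, regular_domain DD omega (D_ n).
Hypothesis D0x0 : D_ 0%N x0.
Hypothesis D_S : forall n, rel_compact (D_ n) (D_ n.+1).
Hypothesis DE : D = \bigcup_n D_ n.
Hypothesis kernelK : forall n, continuous_kernel omega x0 (D_ n) (K n).
Hypothesis compD : compactification D j.
Hypothesis harmonic_u : harmonic_in DD omega D u.
Hypothesis u_ge0 : forall x, D x -> 0 <= u x.

Local Notation L := (L_ D_).
Local Notation P := (P_ DD omega x0 D_ K).
Local Notation H := (HP DD omega x0 D D_).
Local Notation eval := (evalH DD omega x0 D D_).
Local Notation U := (@unif_prod R X L).
Local Notation T := (Dhat * U)%type.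
Local Notation Lambda := (Lambda_ omega x0 D_ K Dhat j u).
Local Notation rho := (rho_ omega x0 D_ K u).
Local Notation corona := (~` (j @` D)).

Let C : set T := [set: Dhat] `*` P.
Let F n (y : X) : T := (j y, T_ D_ K n y).

Let Pc : compact P.
Proof. exact: (P_compact framework regularD_ D0x0 D_S kernelK). Qed.

Let Pcl : closed P.
Proof. exact: (P_closed framework regularD_ D0x0 D_S kernelK). Qed.

Let Hcl : closed H.
Proof. exact: (HP_closed framework regularD_ D0x0 D_S DE kernelK). Qed.

Let HsubP : H `<=` P.
Proof. exact: (HP_sub_P framework regularD_ D0x0 D_S DE kernelK). Qed.

Let TP n y : bdry (D_ n) y -> P (T_ D_ K n y).
Proof. exact: (kernel_in_P framework regularD_ D0x0 D_S kernelK). Qed.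

Let cT n : {within bdry (D_ n), continuous (T_ D_ K n)}.
Proof. exact: (T_continuous D_S kernelK). Qed.

Let inL x : D x -> exists m, L m x.
Proof. by rewrite DE => -[m _ Dmx]; exists m; exact: subset_closure. Qed.

Let cext m x : continuous (fun q : U => ext (q m) x : R).
Proof. exact: (@continuous_ext _ _ L m x). Qed.

Lemma rho_limit (phi : nat -> nat)
    (sigma : {finite_measure set (borel U) -> \bar R}) :
  {homo phi : m n / (m < n)%N} -> carried_by sigma (P : set (borel U)) ->
  weak_cvg P (rho \o phi) sigma ->
  carried_by sigma (H : set (borel U)) /\
  forall x, D x -> ((u x)%:E = \int[sigma]_(g in (H : set (borel U))) (eval g x)%:E)%E.
Proof.
move=> phi_lt [mP sP] lim.
have cid_ : continuous (id : U -> U) by move=> p; exact: cvg_id.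
have compat := limit_compatible framework regularD_ D0x0 D_S DE kernelK harmonic_u
  u_ge0 (prj := id) (F := T_ D_ K) cid_ Pcl (fun p Pp => Pp) cT TP
  (fun n y _ => erefl) phi_lt lim.
have mH : measurable (H : set (borel U)) by exact: closed_borel.
have H0 : sigma (~` H) = 0%E.
  apply: (@subset_measure0 _ _ _ sigma _ (~` P `|` (P `&` [set p | ~ H p]))).
  - exact: (measurableC mH).
  - apply: measurableU; first exact: (measurableC mP).
    by apply: measurableI => //; exact: (measurableC mH).
  - by move=> p nH; have [Pp|nP] := pselect (P p); [right|left].
  - apply/eqP; rewrite eq_le measure_ge0 andbT.
    rewrite (le_trans (measureU2 _ _ _))//.
    + exact: (measurableC mP).
    + by apply: measurableI => //; exact: (measurableC mH).
    + by rewrite [X in (X + _)%E]sP [X in (_ + X)%E]compat adde0.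
split => // x Dx; have [m Lx] := inL Dx.
rewrite (limit_representation framework regularD_ D0x0 D_S DE kernelK harmonic_u
  u_ge0 (prj := id) (F := T_ D_ K) cid_ Pcl cT TP (fun n y _ => erefl) phi_lt lim Lx).
rewrite -(integral_carried Pc mP mH HsubP H0); last first.
  by apply: continuous_subspaceT; exact: cext.
by apply: eq_integral => g /set_mem Hg; rewrite (evalH_ext Hg Lx).
Qed.

Let compC : compact C.
Proof. by apply: compact_setX => //; have [[]] := compD. Qed.

Let csnd : continuous (snd : T -> U). Proof. by move=> p; exact: cvg_snd. Qed.
Let cfst : continuous (fst : T -> Dhat). Proof. by move=> p; exact: cvg_fst. Qed.

Let clC : closed C.
Proof.
rewrite (_ : C = snd @^-1` P); last by apply/seteqP; split => p //= [].
by apply: preimage_closed Pcl => p _; exact: csnd.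
Qed.

Let CP p : C p -> P p.2. Proof. by case. Qed.

Let FC n y : bdry (D_ n) y -> C (F n y).
Proof. by move=> bny; split => //; exact: TP. Qed.

Let cF n : {within bdry (D_ n), continuous (F n)}.
Proof.
have cjn : {within bdry (D_ n), continuous j}.
  have [_ _ cj _ _] := compD.
  by apply: continuous_subspaceW cj; exact: (bdry_exhaustion_sub D_S DE).
apply/subspace_continuousP => y bny.
have h1 := (@subspace_continuousP _ _ _ j).1 cjn y bny.
have h2 := (@subspace_continuousP _ _ _ (T_ D_ K n)).1 (@cT n) y bny.
exact: (cvg_pair h1 h2).
Qed.

Let sndF n y : bdry (D_ n) y -> (F n y).2 = T_ D_ K n y. Proof. by []. Qed.

(** Distances to a dense sequence of the compactification and values at dense
    sequences of the sets L m. *)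
Let separating_family : exists e : nat + nat * nat -> T -> R,
  (forall i, continuous (e i)) /\
  forall p q, C p -> C q -> (forall i, e i p = e i q) -> p = q.
Proof.
have [[compDhat _] _ _ _ _] := compD.
have [dh _ dhP] := compact_dense_seq compDhat (I : [set: Dhat] (j x0)).
have dn m : exists d : nat -> X, (forall i, L m (d i)) /\
    forall x (e : R), L m x -> 0 < e -> exists i, ball (d i) e x.
  have [d dL dd] := compact_dense_seq (@L_compact _ _ _ D_S m) (L_pole D0x0 D_S m).
  by exists d.
have [d /all_and2[dL dd]] := choice dn.
pose e (k : nat + nat * nat) (p : T) : R := match k with
  | inl i => mdist (dh i) p.1
  | inr mi => ext (p.2 mi.1) (d mi.1 mi.2) end.
exists e; split.
  case=> [i|[m i]] p.
    apply: (@continuous_comp T Dhat R fst (mdist (dh i))); first exact: cfst.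
    exact: continuous_mdist.
  apply: (@continuous_comp T U R snd (fun q : U => ext (q m) (d m i))).
    exact: csnd.
  exact: cext.
move=> [h p] [h' p'] [_ /= Pp] [_ /= Pp'] ee; congr (_, _).
  apply: mdist_positivity; apply/eqP; rewrite -normr_le0.
  apply/ler_addgt0Pr => r r0; rewrite add0r ger0_norm ?mdist_ge0//.
  have r2 : 0 < r / 2 by rewrite divr_gt0.
  have [i] := dhP h (r / 2) I r2; rewrite ballEmdist => di.
  have di1 : mdist (dh i) h < r / 2 := di.
  have di2 : mdist (dh i) h = mdist (dh i) h' := ee (inl i).
  have tri : mdist h h' <= mdist h (dh i) + mdist (dh i) h'.
    exact: metric_triangle.
  rewrite (metric_sym h (dh i)) in tri.
  apply: (le_trans tri); rewrite -di2; lra.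
apply: unif_prod_eq => m s Ls.
apply/eqP; rewrite -subr_eq0 -normr_le0; apply/ler_addgt0Pr => r r0.
have r3 : 0 < r / 3 by rewrite divr_gt0.
have cp (q : U) : P q -> {within L m, continuous (ext (q m))}.
  move=> Pq; have [c _ _ _] := Pq m.
  exact: (@subspace_valL_continuousP' X (L m) R 0 _).2.
have n1 := (within_continuousP _ _).1 (cp _ Pp) s Ls _ r3.
have n2 := (within_continuousP _ _).1 (cp _ Pp') s Ls _ r3.
have [r' /= r'0 sr'] := (nbhs_ballP s _).1 (filterI n1 n2).
have [i /ball_sym di] := dd m s r' Ls r'0.
have [/(_ (dL m i)) h1 /(_ (dL m i)) h2] := sr' _ di.
have ei : ext (p m) (d m i) = ext (p' m) (d m i) := ee (inr (m, i)).
rewrite ei in h1.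
by move: h1 h2; rewrite add0r ler_norml !ltr_norml; lra.
Qed.

Lemma Lambda_subsequence : exists2 phi : nat -> nat, {homo phi : m n / (m < n)%N} &
  exists Lam : {finite_measure set (borel T) -> \bar R},
    carried_by Lam (C : set (borel T)) /\ weak_cvg C (Lambda \o phi) Lam.
Proof.
have image n := boundary_image framework regularD_ D0x0 D_S DE harmonic_u u_ge0
  clC cF FC n.
have [mu muP] := choice image.
have [e [ce sep]] := separating_family.
have [y0 by0] := framework_bdry framework (regularD_ 0%N).1.
have muC n : mu n (~` C) = 0%E by have [] := muP n.
have muT n : mu n setT = (u x0)%:E by have [] := muP n.
have [phi phi_lt [Lam [cLam lim]]] :=
  weak_sequential_compactness compC clC (FC by0) ce sep muC muT.
exists phi => //; exists Lam; split => //.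
have -> // : Lambda \o phi = (fun n => (mu \o phi) n : set (borel T) -> \bar R).
by apply/funext => n /=; have [->] := muP (phi n).
Qed.

Section limit.
Variables (phi : nat -> nat) (Lam : {finite_measure set (borel T) -> \bar R}).
Hypothesis phi_lt : {homo phi : m n / (m < n)%N}.
Hypothesis LamC : carried_by Lam (C : set (borel T)).
Hypothesis lim : weak_cvg C (Lambda \o phi) Lam.

(** The image of each D_ m is a countable union of balls around the points of a
    dense sequence, and the boundaries of the later domains avoid these balls;
    f i l is positive exactly on the ball of radius 1/(l+1). *)
Let interior_null : exists Z : set (borel T), [/\ measurable Z, Lam Z = 0%E &
  C `&` [set p | (j @` D) p.1] `<=` Z].
Proof.
have [[compDhat _] _ _ _ _] := compD.
have [dh _ dhP] := compact_dense_seq compDhat (I : [set: Dhat] (j x0)).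
pose f (i l : nat) (p : T) : R :=
  `|l.+1%:R^-1 - mdist (dh i) p.1| + (l.+1%:R^-1 - mdist (dh i) p.1).
have cf i l : continuous (f i l).
  have cd : continuous (fun p : T => l.+1%:R^-1 - mdist (dh i) p.1).
    move=> p; apply: cvgB; first exact: cvg_cst.
    apply: (@continuous_comp T Dhat R fst (mdist (dh i))); first exact: cfst.
    exact: continuous_mdist.
  by move=> p; apply: cvgD; [apply: cvg_norm; exact: cd|exact: cd].
have f_ge0 i l p : 0 <= f i l p.
  by rewrite /f -lerBlDr sub0r -normrN ler_norm.
have fE i l p : (f i l p == 0) = ~~ (mdist (dh i) p.1 < l.+1%:R^-1).
  rewrite /f -leNgt; case: (leP l.+1%:R^-1 (mdist (dh i) p.1)) => h.
    by rewrite ler0_norm ?subr_le0// addNr eqxx.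
  by rewrite gtr0_norm ?subr_gt0//; apply/negbTE; rewrite gt_eqF// addr_gt0 ?subr_gt0.
pose inside (k : nat * (nat * nat)) :=
  ball (dh k.2.1) (k.2.2.+1%:R^-1 : R) `<=` j @` (D_ k.1).
pose Z (n : nat) : set (borel T) :=
  if @unpickle (nat * (nat * nat))%type n is Some k then
    if `[< inside k >] then C `&` [set p | f k.2.1 k.2.2 p <> 0] else set0
  else set0.
have mf i l : measurable (C `&` [set p | f i l p <> 0] : set (borel T)).
  rewrite (_ : [set p | f i l p <> 0] = ~` (f i l @^-1` [set 0])); last by [].
  apply: measurableI; first exact: closed_borel.
  apply: open_borel; apply: closed_openC.
  by apply: preimage_closed; [move=> p _; exact: cf|exact: closed_eq].
have mZ n : measurable (Z n).
  by rewrite /Z; case: unpickle => // k; case: ifP => // _; exact: mf.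
have Z0 n : Lam (Z n) = 0%E.
  rewrite /Z; case: unpickle => [[m [i l]]|]; last by rewrite measure0.
  case: asboolP => [ins|_]; last by rewrite measure0.
  apply: (limit_null framework regularD_ D0x0 D_S DE harmonic_u u_ge0 clC cF FC
    phi_lt lim (N := m)); [exact: cf|by move=> p _; exact: f_ge0|].
  move=> n' y mn bny; apply/eqP; rewrite fE; apply/negP => dy.
  apply: (bdry_image_escape framework regularD_ D_S DE compD mn bny).
  by apply: ins; rewrite ballEmdist.
exists (\bigcup_n Z n); split; [exact: bigcupT_measurable|exact: null_bigcup|].
move=> p [Cp [x]]; rewrite {1}DE => -[m _ Dmx] jx.
have jp : (j @` (D_ m)) p.1 by exists x.
have om : open (j @` (D_ m)).
  exact: (open_image_exhaustion framework regularD_ D_S DE compD).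
have [e /= e0 se] := (nbhs_ballP p.1 _).1 (open_nbhs_nbhs (conj om jp)).
have e2 : 0 < e / 2 by rewrite divr_gt0.
have [l le] : exists l : nat, l.+1%:R^-1 < e / 2.
  by have [l _ /(_ l (leqnn l))] := near_infty_natSinv_lt (PosNum e2); exists l.
have [i di] := dhP p.1 l.+1%:R^-1 I (ltac:(by rewrite invr_gt0)).
exists (pickle (m, (i, l))) => //; rewrite /Z pickleK ifT; last first.
  apply/asboolP => z dz; apply: se; rewrite (splitr e).
  apply: (@le_ball _ _ p.1 (l.+1%:R^-1 + l.+1%:R^-1)); first by rewrite lerD// ltW.
  by apply: ball_triangle dz; exact: ball_sym.
split => //=; apply/eqP; rewrite fE negbK.
by move: di; rewrite ballEmdist.
Qed.

Let mCc : measurable (C : set (borel T)). Proof. exact: closed_borel. Qed.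

Let clE : closed (corona `*` H : set T).
Proof.
rewrite (_ : corona `*` H = fst @^-1` corona `&` snd @^-1` H)//.
apply: closedI.
  apply: preimage_closed => [p _|]; first exact: cfst.
  exact: (closed_corona framework regularD_ D_S DE compD).
by apply: preimage_closed Hcl => p _; exact: csnd.
Qed.

Let ECsub : corona `*` H `<=` C.
Proof. by move=> [h p] [/= _ Hp]; split => //=; exact: HsubP. Qed.

(** The complement is covered by three null sets: the complement of C, the
    incompatible part of C, and the part of C over j(D). *)
Lemma Lambda_limit_carried : carried_by Lam (corona `*` H : set (borel T)).
Proof.
have mE : measurable (corona `*` H : set (borel T)) by exact: closed_borel.
split => //.
have [Z [mZ Z0 sZ]] := interior_null.
have compat := limit_compatible framework regularD_ D0x0 D_S DE kernelK harmonic_u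
  u_ge0 csnd clC CP cF FC sndF phi_lt lim.
pose N1 : set (borel T) := C `&` [set p | ~ H p.2].
have mN1 : measurable N1.
  apply: measurableI => //; apply: open_borel; apply: closed_openC.
  by apply: preimage_closed Hcl => p _; exact: csnd.
have mCC : measurable (~` C : set (borel T)) by exact: measurableC.
apply: (@subset_measure0 _ _ _ Lam _ (~` C `|` (N1 `|` Z))).
- exact: measurableC.
- by apply: measurableU => //; exact: measurableU.
- move=> p nE; have [Cp|nC] := pselect (C p); last by left.
  right; have [Hp|nH] := pselect (H p.2); last by left; split.
  right; apply: sZ; split => //; apply: contrapT => njD; apply: nE; split => //.
- apply/eqP; rewrite eq_le measure_ge0 andbT.
  rewrite (le_trans (measureU2 _ _ _))//; first exact: measurableU.
  rewrite [X in (X + _)%E](LamC.2) add0e (le_trans (measureU2 _ _ _))//.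
  by rewrite [X in (X + _)%E]compat [X in (_ + X)%E]Z0 adde0.
Qed.

Lemma Lambda_limit_mass : Lam C = (u x0)%:E.
Proof.
exact: (limit_mass framework regularD_ D0x0 D_S DE harmonic_u u_ge0 clC cF FC
  phi_lt lim).
Qed.

Lemma Lambda_limit_representation x : D x ->
  ((u x)%:E = \int[Lam]_(p in (corona `*` H : set (borel T))) (eval p.2 x)%:E)%E.
Proof.
move=> Dx; have [m Lx] := inL Dx.
have [mE E0] := Lambda_limit_carried.
rewrite (limit_representation framework regularD_ D0x0 D_S DE kernelK harmonic_u
  u_ge0 csnd clC cF FC sndF phi_lt lim Lx).
rewrite -(integral_carried compC mCc mE ECsub E0); last first.
  apply: continuous_subspaceT => p.
  apply: (@continuous_comp T U R snd (fun q : U => ext (q m) x)); first exact: csnd.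
  exact: cext.
by apply: eq_integral => p /set_mem[_ Hp]; rewrite (evalH_ext Hp Lx).
Qed.

End limit.
End main.

Theorem lemma4p5 (R : realType) (X : pmetricType R)
  (DD : set (set X)) (omega : set X -> X -> probability (borel X) R)
  (D : set X) (x0 : X) (D_ : nat -> set X) (K : nat -> X -> X -> R)
  (Dhat : pmetricType R) (j : X -> Dhat) (u : X -> R)
  (framework : harmonic_framework DD omega)
  (domainD : domain D) (Dx0 : D x0)
  (regularD_ : forall n, regular_domain DD omega (D_ n))
  (D0x0 : D_ 0%N x0)
  (D_S : forall n, rel_compact (D_ n) (D_ n.+1))
  (DE : D = \bigcup_n D_ n)
  (kernelK : forall n, continuous_kernel omega x0 (D_ n) (K n))
  (compD : compactification D j)
  (harmonic_u : harmonic_in DD omega D u)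
  (u_ge0 : forall x, D x -> 0 <= u x) :
  let P := P_ DD omega x0 D_ K in
  let H := HP DD omega x0 D D_ in
  let eval := evalH DD omega x0 D D_ in
  let Lambda := Lambda_ omega x0 D_ K Dhat j u in
  let rho := rho_ omega x0 D_ K u in
  let corona := ~` (j @` D) in
  [/\ (exists phi : nat -> nat, {homo phi : m n / (m < n)%N} /\
        exists Lam : {finite_measure set
            (borel (Dhat * @unif_prod R X (L_ D_))%type) -> \bar R},
          carried_by Lam ([set: Dhat] `*` P) /\
          weak_cvg ([set: Dhat] `*` P) (Lambda \o phi) Lam),
      (forall (phi : nat -> nat)
          (Lam : {finite_measure set
            (borel (Dhat * @unif_prod R X (L_ D_))%type) -> \bar R}),
        {homo phi : m n / (m < n)%N} ->
        carried_by Lam ([set: Dhat] `*` P) ->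
        weak_cvg ([set: Dhat] `*` P) (Lambda \o phi) Lam ->
        [/\ carried_by Lam (corona `*` H),
            Lam ([set: Dhat] `*` P) = (u x0)%:E
          & forall x, D x ->
              (u x)%:E =
              (\int[Lam]_(p in corona `*` H) (eval p.2 x)%:E)%E]),
      (forall (phi : nat -> nat)
          (sigma : {finite_measure set
            (borel (@unif_prod R X (L_ D_))) -> \bar R}),
        {homo phi : m n / (m < n)%N} ->
        carried_by sigma P ->
        weak_cvg P (rho \o phi) sigma ->
        carried_by sigma H /\
        forall x, D x -> (u x)%:E = (\int[sigma]_(g in H) (eval g x)%:E)%E)
    & forall (tau : {finite_measure set
          (borel (@locunif R X D)) -> \bar R})
        (A : set (borel (@locunif R X D))),
        carried_by tau (H1 DD omega x0 D) ->
        measurable A -> A `<=` H1 DD omega x0 D ->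
        let uA x := \int[tau]_(h in A) ext (A := D) h x in
        [/\ forall x, D x ->
              tau.-integrable A (fun h => (ext (A := D) h x)%:E),
            {within D, continuous uA} /\ harmonic_in DD omega D uA,
            (uA x0)%:E = tau A,
            (0 < tau A)%E -> forall x, D x -> 0 < uA x
          & ~ (0 < tau A)%E -> forall x, D x -> uA x = 0]].
Proof.
split.
- have [phi phi_lt [Lam LamP]] := Lambda_subsequence framework regularD_ D0x0 D_S DE
    kernelK compD harmonic_u u_ge0.
  by exists phi; split => //; exists Lam.
- move=> phi Lam phi_lt LamC lim; split.
  + exact: (Lambda_limit_carried framework regularD_ D0x0 D_S DE kernelK compD
      harmonic_u u_ge0 phi_lt LamC lim).
  + exact: (Lambda_limit_mass framework regularD_ D0x0 D_S DE kernelK compD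
      harmonic_u u_ge0 phi_lt lim).
  + move=> x; exact: (Lambda_limit_representation framework regularD_ D0x0 D_S DE
      kernelK compD harmonic_u u_ge0 phi_lt LamC lim).
- exact: (rho_limit framework regularD_ D0x0 D_S DE kernelK harmonic_u u_ge0).
- move=> tau A tauH mA AH uA; split.
  + exact: (mixture_integrable framework regularD_ D0x0 D_S DE kernelK).
  + split; first exact: (mixture_continuous framework regularD_ D0x0 D_S DE kernelK).
    exact: (mixture_harmonic framework regularD_ D0x0 D_S DE kernelK).
  + exact: (mixture_pole tau mA AH).
  + move=> tA x; exact: (mixture_gt0 framework regularD_ D0x0 D_S DE kernelK).
  + move=> tA x; exact: mixture_eq0.
Qed.
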